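(* Let $(Y_i(0),\beta_{is},w_{is},\mathcal{X}_s)_{1\le i\le N,\,1\le s\le S}$ be a triangular array as in the context (indexed by $S$, with $N=N_S$), let $X_i=\sum_{s=1}^S w_{is}\mathcal{X}_s$, $n_s=\sum_{i=1}^N w_{is}$, and let $\mathcal{F}_0$ be the $\sigma$-field generated by $(Y_i(0),\beta_{is},w_{is})_{i,s}$. Suppose: (1) the observed outcome is $Y_i=Y_i(0)+\sum_{s=1}^S w_{is}\mathcal{X}_s\beta_{is}$ for all $i$; (2) $E[\mathcal{X}_s\mid\mathcal{F}_0]=0$ for all $s$; (3) conditional on $\mathcal{F}_0$, the variables $\mathcal{X}_1,\dots,\mathcal{X}_S$ are independent; (4) $\max_s n_s/\sum_{t=1}^S n_t\to 0$; (5) the support of $\beta_{is}$ is bounded (uniformly in $i,s,S$); (6) $\frac1N\sum_{i=1}^N\sum_{s=1}^S \mathrm{var}(\mathcal{X}_s\mid\mathcal{F}_0)\,w_{is}^2$ converges in probability to a strictly positive non-random limit; (7) for some $\nu>0$, $E[|\mathcal{X}_s|^{2+\nu}\mid\mathcal{F}_0]$ exists and is uniformly bounded, and conditional on $W=(w_{is})$ the second moments of $Y_i(0)$ exist and are bounded uniformly over $i$. Let $$\hat\beta=\frac{\sum_{i=1}^N X_iY_i}{\sum_{i=1}^N X_i^2},\qquad \beta=\frac{\sum_{i=1}^N E[X_iY_i\mid\mathcal{F}_0]}{\sum_{i=1}^N E[X_i^2\mid\mathcal{F}_0]}.$$ Then, with $\pi_{is}=w_{is}^2\,\mathrm{var}(\mathcal{X}_s\mid\mathcal{F}_0)$,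 $$\beta=\frac{\sum_{i=1}^N\sum_{s=1}^S\pi_{is}\beta_{is}}{\sum_{i=1}^N\sum_{s=1}^S\pi_{is}}\qquad\text{and}\qquad \hat\beta=\beta+o_p(1).$$
   Context: All limits are as $S\to\infty$, with the number of regions $N=N_S$ depending on $S$. For each $S$ there are, on some probability space, random variables $Y_i(0)\in\mathbb{R}$, $\beta_{is}\in\mathbb{R}$, shares $w_{is}\ge 0$ with $\sum_{s=1}^S w_{is}\le 1$ for every $i$, and shifters $\mathcal{X}_s\in\mathbb{R}$ ($i=1,\dots,N$, $s=1,\dots,S$); their joint distribution may change with $S$ (the index $S$ is suppressed). $W=(w_{is})$ is the $N\times S$ share matrix. ''Uniformly bounded'' means bounded (almost surely) by a non-random constant not depending on $S$. Limit conditions on functions of $W$ alone are understood to hold almost surely. $o_p(1)$ denotes a sequence converging to zero in probability. Ratios are understood where denominators are non-zero. *)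

(* Defs.v *)
From HB Require Import structures.
From mathcomp Require Import all_boot all_order all_algebra.
From mathcomp Require Import all_classical all_reals all_analysis.
From mathcomp Require Import measurable_realfun.

Set Implicit Arguments.
Unset Strict Implicit.
Unset Printing Implicit Defensive.

Import Order.TTheory GRing.Theory Num.Theory.
Import numFieldNormedType.Exports.

Local Open Scope classical_set_scope.
Local Open Scope ring_scope.

Section conditional_expectation.
Context d (T : measurableType d) (R : realType) (P : probability T R).
Implicit Types (G : set (set T)) (f g : T -> R).

(* A sub-sigma-algebra is given by a family G generating it: conditioning on G
   means conditioning on <<s G >>. *)
Definition is_condE G f g : Prop :=
  [/\ P.-integrable [set: T] (EFin \o f),
      measurable_fun [set: g_sigma_algebraType G] g,
      P.-integrable [set: T] (EFin \o g) &
      forall A : set T, <<s G >> A ->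
        (\int[P]_(x in A) (g x)%:E = \int[P]_(x in A) (f x)%:E)%E].

(* A chosen version of E[f | <<s G >>]. When <<s G >> consists of measurable
   sets, it is a version for every integrable f (condE_version); for f not
   integrable it has the meaningless value 0. *)
Definition condE G f : T -> R := xget (cst 0) [set g | is_condE G f g].

Definition condVar G f : T -> R := condE G (fun x => (f x - condE G f x) ^+ 2).

Definition condP G (A : set T) : T -> R := condE G \1_A.

(* Null events depend on B, as usual for conditional probabilities; taking some
   B s to be the full line gives the product rule for subfamilies. *)
Definition cond_independent G n (X : 'I_n -> {RV P >-> R}) : Prop :=
  forall B : 'I_n -> set R, (forall s, measurable (B s)) ->
    {ae P, forall x, condP G (\bigcap_(s in [set: 'I_n]) (X s @^-1` B s)) x =
                     \prod_(s < n) condP G (X s @^-1` B s) x}.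

Lemma condE_version G f : (forall A, G A -> measurable A) ->
  P.-integrable [set: T] (EFin \o f) -> is_condE G f (condE G f).
Proof.
move=> mG intf; rewrite /condE; case: xgetP => [g _ //|noversion].
exfalso.
pose T' : measurableType _ := g_sigma_algebraType G.
pose i : T -> T' := idfun.
have subG (A : set T) : <<s G >> A -> measurable A.
  move: A; apply: smallest_sub; first exact: sigma_algebra_measurable.
  by move=> A /mG.
have mi : measurable_fun [set: T] i by move=> _ A mA; rewrite setTI; exact: (subG _ mA).
pose iM : {mfun T >-> T'} := HB.pack i (isMeasurableFun.Build _ _ _ _ i mi).
pose mu : probability T' R := distribution P iM.
pose nu0 : set T' -> \bar R := fun A => induced_charge intf A.
have nu0_add : semi_sigma_additive nu0.
  move=> F mF tF mUF.
  have := @charge_semi_sigma_additive _ _ _ (induced_charge intf) F; apply.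
  - by move=> n; exact: (subG _ (mF n)).
  - by [].
  - exact: (subG _ mUF).
have nu0_0 : nu0 set0 = 0%E by exact: (charge0 (induced_charge intf)).
have nu0_fin A : measurable A -> nu0 A \is a fin_num.
  by move=> mA; exact: (@fin_num_measure _ _ _ (induced_charge intf) _ (subG _ mA)).
pose nu : {charge set T' -> \bar R} :=
  HB.pack nu0 (isCharge.Build _ _ _ nu0 nu0_0 nu0_fin nu0_add).
have numu : nu `<< mu.
  apply/null_content_dominatesP => A mA muA.
  apply: null_set_integral => //; first exact: (subG _ mA).
  have mf := measurable_int P intf.
  exact: (measurable_funS measurableT (@subsetT T A) mf).
pose h := Radon_Nikodym nu mu.
have hint : mu.-integrable [set: T'] h by exact: Radon_Nikodym_integrable.
have mh := measurable_int mu hint.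
pose g : T -> R := fine \o h.
have hg : EFin \o g = h.
  by apply/funext => x /=; rewrite fineK//; exact: Radon_Nikodym_fin_num.
have Pint : P.-integrable [set: T] (h \o i).
  apply/integrableP; split.
    move=> _ B mB; rewrite setTI; apply: subG.
    by have := mh measurableT B mB; rewrite setTI.
  have /integrableP[_] := hint.
  rewrite (ge0_integral_pushforward mi)//.
  exact: (measurable_int mu (integrable_abse hint)).
apply: (noversion g); split => //.
- by apply/measurable_EFinP; rewrite hg.
- by rewrite hg.
- move=> A GA; rewrite -/(comp EFin g) hg.
  transitivity (\int[mu]_(x in A) h x)%E; last first.
    by rewrite -Radon_Nikodym_integral.
  rewrite integral_pushforward//.
  exact: (integrableS measurableT (subG _ GA) _ Pint).
Qed.

End conditional_expectation.

(* Topological support of the law of Z. *)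
Definition rv_support d (T : measurableType d) (R : realType)
    (P : probability T R) (Z : {RV P >-> R}) : set R :=
  [set z | forall e : R, 0 < e -> (0 < P (Z @^-1` ball z e))%E].

(* Each term of the sequence may live on its own probability space. *)
Definition cvg_in_prob (R : realType) (d : nat -> measure_display)
    (T : forall S, measurableType (d S)) (P : forall S, probability (T S) R)
    (Z : forall S, T S -> R) (l : R) : Prop :=
  forall e : R, 0 < e ->
    P S [set x | e <= `|Z S x - l|] @[S --> \oo] --> 0%E.

Section shift_share.
Context d (T : measurableType d) (R : realType) (P : probability T R).
Variables (N S : nat).
Implicit Types (Y : 'I_N -> {RV P >-> R}) (X : 'I_S -> {RV P >-> R}).
Implicit Types (w b : 'I_N -> 'I_S -> {RV P >-> R}).

(* Generating families, to be used as first argument of condE, condVar, etc. *)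
Definition gen_W w : set (set T) :=
  \bigcup_i \bigcup_s g_sigma_algebra_preimage (w i s).

Definition gen_F0 (Y0 : 'I_N -> {RV P >-> R}) b w : set (set T) :=
  (\bigcup_i g_sigma_algebra_preimage (Y0 i)) `|`
  (\bigcup_i \bigcup_s g_sigma_algebra_preimage (b i s)) `|`
  gen_W w.

Definition shifter w X i (x : T) : R := \sum_(s < S) w i s x * X s x.

Definition size_sector w s (x : T) : R := \sum_(i < N) w i s x.

Definition max_sector_share w (x : T) : R :=
  (\big[Num.max/0]_(s < S) size_sector w s x) / \sum_(t < S) size_sector w t x.

Definition beta_hat Y w X (x : T) : R :=
  (\sum_(i < N) shifter w X i x * Y i x) / \sum_(i < N) shifter w X i x ^+ 2.

Definition estimand (F : set (set T)) Y w X (x : T) : R :=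
  (\sum_(i < N) condE P F (fun y => shifter w X i y * Y i y) x) /
  \sum_(i < N) condE P F (fun y => shifter w X i y ^+ 2) x.

Definition pi_weight (F : set (set T)) w X i s (x : T) : R :=
  w i s x ^+ 2 * condVar P F (X s) x.

End shift_share.

(* Main.v *)
(* Everything is reduced to unconditional second moments. Let F_s be generated by F_0
   and the X_t with t < s: conditional independence makes X_1, ..., X_S a martingale
   difference sequence for this filtration. With A = (a_st), a_st = N^-1 sum_i w_is w_it b_it,
   the error of the numerator is the sum of
   - a linear form in X with coefficients N^-1 sum_i w_is Y_i(0),
   - the off-diagonal quadratic form, which is again a martingale transform,
   - the diagonal form sum_s a_ss (X_s^2 - var X_s), where X_s^2 is truncated at a fixed
     level and the remainder is controlled by the moment of order 2 + nu.
   The second moments of the first two and of the truncated diagonal form are at most a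
   constant times the expectation of sum_s n_s^2 / N^2, which is at most the share of the
   largest sector. The denominator is the case Y(0) = 0 and b = 1. *)
From HB Require Import structures.
From mathcomp Require Import all_boot all_order all_algebra.
From mathcomp Require Import all_classical all_reals all_analysis.
From mathcomp Require Import measurable_realfun ring lra.
Require Import Defs.
Set Implicit Arguments.
Unset Strict Implicit.
Unset Printing Implicit Defensive.
Import Order.TTheory GRing.Theory Num.Theory.
Import numFieldNormedType.Exports.
Local Open Scope classical_set_scope.
Local Open Scope ring_scope.
(** * Conditional expectation *)

(** Three obstacles shape the proof. With moments of order [2 + nu] only, X_s^2 need not be square
    integrable, so the tail of the diagonal form is measured in mean absolute value; there sum_s
    |a_ss| is bounded but not small, and the smallness has to come from the truncation level. The
    moments of the shifters are controlled given F_0, those of Y_i(0) only given the weights; the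
    linear form is therefore estimated by Cauchy-Schwarz, which leaves coefficients of Y_i(0)^2 that
    depend on the weights alone. Finally, the normalized numerator of the estimand need not
    converge; the ratio is stable because bounded effects keep this numerator below a constant times
    the denominator, whose normalized limit is positive. Conditional moments mostly enter as
    relations between integrals over the sets of a sub-sigma-algebra, so passing to unconditional
    moments amounts to inserting measurable multipliers. *)

Section sub_sigma_algebra.
Import HBNNSimple.
Context d (T : measurableType d) (R : realType) (P : probability T R).
Variables (G : set (set T)) (sG : forall A, <<s G >> A -> measurable A).
Implicit Types f g H D : T -> R.

Lemma funrposB f x : f^\+ x - f^\- x = f x.
Proof. by rewrite -[in RHS](funrposBneg f). Qed.

Lemma sub_measurable_fun d' (U : measurableType d') (f : T -> U) :
  measurable_fun [set: g_sigma_algebraType G] f -> measurable_fun [set: T] f.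
Proof. by move=> mf _ B mB; exact: (sG (mf measurableT B mB)). Qed.

(** The level sets of [h] belong to [<<s G >>], so the right-hand side sees [f] only through its
    integrals over sets of that sigma-algebra. *)
Lemma integral_nnsfun_mul (h : {nnsfun (g_sigma_algebraType G) >-> R}) f :
  measurable_fun setT f -> (forall x, 0 <= f x) ->
  (\int[P]_x (h x * f x)%:E =
   \sum_(y \in range h) (y%:E * \int[P]_(x in h @^-1` [set y]) (f x)%:E))%E.
Proof.
move=> mf f0.
have mh y : measurable (h @^-1` [set y] : set T).
  by apply: sG; exact: (measurable_funPTI h).
have mi y : measurable_fun [set: T] (fun x => y * \1_(h @^-1` [set y]) x).
  by apply: measurable_funM => //; exact: measurable_indic.
have i0 y (x : T) : 0 <= y * \1_(h @^-1` [set y]) x.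
  by rewrite -lee_fin nnfun_muleindic_ge0.
transitivity (\int[P]_x (\sum_(y \in range h)
    (y * \1_(h @^-1` [set y]) x * f x)%:E))%E.
  apply: eq_integral => x _; under eq_fsbigr do rewrite EFinM.
  rewrite -ge0_mule_fsuml => [|y]; last by rewrite lee_fin.
  by rewrite fsumEFin// -(fimfunE h x) EFinM.
rewrite ge0_integral_fsum//; last 2 first.
- by move=> y; apply: measurableT_comp => //; exact: measurable_funM.
- by move=> y x _; rewrite lee_fin mulr_ge0.
apply: eq_fsbigr => y; rewrite inE => -[z _ <-].
under eq_integral do rewrite -mulrA EFinM.
have mhz : measurable_fun [set: T]
    (fun x => (\1_(h @^-1` [set h z] : set T) x * f x)%:E).
  by apply: measurableT_comp => //; apply: measurable_funM => //; exact: measurable_indic.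
have -> : (\int[P]_x ((h z)%:E * (\1_(h @^-1` [set h z] : set T) x * f x)%:E) =
    (h z)%:E * \int[P]_x (\1_(h @^-1` [set h z] : set T) x * f x)%:E)%E.
  by apply: ge0_integralZl => // [x _|]; rewrite lee_fin// mulr_ge0.
rewrite [in RHS]integral_mkcond; congr (_ * _)%E.
by apply: eq_integral => x _; rewrite epatch_indic/= muleC.
Qed.

(** Simple multipliers are handled by their level sets, general ones by monotone convergence. Both
    sides may be infinite, which later allows integrability of a product to be deduced from this
    inequality. *)
Lemma le_integral_mul f g H :
  measurable_fun setT f -> measurable_fun setT g ->
  (forall x, 0 <= f x) -> (forall x, 0 <= g x) ->
  measurable_fun [set: g_sigma_algebraType G] H -> (forall x, 0 <= H x) ->
  (forall A, <<s G >> A ->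
    \int[P]_(x in A) (f x)%:E <= \int[P]_(x in A) (g x)%:E)%E ->
  (\int[P]_x (H x * f x)%:E <= \int[P]_x (H x * g x)%:E)%E.
Proof.
move=> mf mg f0 g0 mH H0 fg.
have mH' : measurable_fun [set: g_sigma_algebraType G] (EFin \o H).
  exact/measurable_EFinP.
pose h := nnsfun_approx measurableT mH'.
have mh n : measurable_fun [set: T] (h n).
  exact: (sub_measurable_fun (@measurable_funPT _ _ _ _ (h n))).
have appr (k : T -> R) : measurable_fun setT k -> (forall x, 0 <= k x) ->
    (\int[P]_x (h n x * k x)%:E @[n --> \oo] --> \int[P]_x (H x * k x)%:E)%E.
  move=> mk k0.
  have -> : (\int[P]_x (H x * k x)%:E =
      \int[P]_x (limn (fun n => (h n x * k x)%:E)))%E.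
    apply: eq_integral => x _; apply/esym/cvg_lim => //.
    under eq_fun do rewrite EFinM; rewrite EFinM.
    apply: cvgeZr => //.
    have := @cvg_nnsfun_approx _ _ _ _ measurableT _ mH'.
    by move=> /(_ _ x); apply => // y _; rewrite /= lee_fin.
  apply: cvg_monotone_convergence => //.
  - by move=> n; apply: measurableT_comp => //; exact: measurable_funM.
  - by move=> n x _; rewrite lee_fin mulr_ge0.
  - move=> x _ a b ab; rewrite lee_fin ler_wpM2r//.
    by have /lefP := @nd_nnsfun_approx _ _ _ _ measurableT _ mH' _ _ ab; exact.
rewrite -(cvg_lim _ (appr f mf f0))// -(cvg_lim _ (appr g mg g0))//.
apply: lee_lim; [by apply/cvg_ex; eexists; exact: appr..|].
apply: nearW => n; rewrite !integral_nnsfun_mul//.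
apply: lee_fsum => // y [x _ <-].
apply: lee_wpmul2l; first by rewrite lee_fin.
by apply: fg; exact: (measurable_funPTI (h n)).
Qed.

(* The sign of [D] cannot be controlled, so the identity is obtained from the
   inequality for the positive and negative parts of [D], and then of [H]. *)
Lemma integral_mul_eq0 D H :
  P.-integrable setT (EFin \o D) ->
  measurable_fun [set: g_sigma_algebraType G] H ->
  P.-integrable setT (EFin \o (fun x => H x * D x)) ->
  (forall A, <<s G >> A -> \int[P]_(x in A) (D x)%:E = 0)%E ->
  (\int[P]_x (H x * D x)%:E = 0)%E.
Proof.
move=> iD mH iHD D0.
have mD : measurable_fun setT D by apply/measurable_EFinP; exact: measurable_int iD.
have mHT := sub_measurable_fun mH.
have split_D A : <<s G >> A ->
    (\int[P]_(x in A) (D^\+ x)%:E = \int[P]_(x in A) (D^\- x)%:E)%E.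
  move=> GA; have mA := sG GA.
  have iDA := integrableS measurableT mA (@subsetT _ _) iD.
  have ip := integrable_funrpos mA iDA; have inn := integrable_funrneg mA iDA.
  have fp := integrable_fin_num mA ip; have fn := integrable_fin_num mA inn.
  have e0 : (\int[P]_(x in A) (D^\+ x)%:E - \int[P]_(x in A) (D^\- x)%:E = 0)%E.
    rewrite -integralB// -[RHS](D0 A GA); apply/eq_integral => x _.
    by rewrite -EFinB funrposB.
  move: e0; rewrite -(fineK fp) -(fineK fn) -EFinB => -[] /eqP.
  by rewrite subr_eq0 => /eqP ->.
have eqH (K : T -> R) : measurable_fun [set: g_sigma_algebraType G] K -> (forall x, 0 <= K x) ->
    (\int[P]_x (K x * D^\+ x)%:E = \int[P]_x (K x * D^\- x)%:E)%E.
  move=> mK K0; apply/eqP; rewrite eq_le; apply/andP; split; apply: le_integral_mul => //;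
    try exact: measurable_funrpos; try exact: measurable_funrneg;
    try exact: funrpos_ge0; try exact: funrneg_ge0;
    by move=> A GA; rewrite split_D.
(* The positive and negative parts of [H] both lie between 0 and [|H|]; under this condition the
   products with [D] and with its parts inherit integrability from [H * D]. *)
have sub (K : T -> R) : measurable_fun [set: g_sigma_algebraType G] K -> (forall x, 0 <= K x <= `|H x|) ->
    P.-integrable setT (EFin \o (fun x => K x * D x)) /\
    (\int[P]_x (K x * D x)%:E = 0)%E.
  move=> mK K0.
  have mKT := sub_measurable_fun mK.
  have iKD' (E : T -> R) : measurable_fun setT E -> (forall x, `|E x| <= `|D x|) ->
      P.-integrable setT (EFin \o (fun x => K x * E x)).
    move=> mE ED; apply: le_integrable iHD => //.
      by apply/measurable_EFinP; exact: measurable_funM.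
    move=> x _; rewrite lee_fin !normrM; have /andP[k0 k1] := K0 x.
    by rewrite ler_pM// ger0_norm.
  have ip : P.-integrable setT (EFin \o (fun x => K x * D^\+ x)).
    apply: iKD'; first exact: measurable_funrpos.
    move=> x; rewrite ger0_norm ?funrpos_ge0// /funrpos.
    by rewrite ge_max normr_ge0 ler_norm.
  have inn : P.-integrable setT (EFin \o (fun x => K x * D^\- x)).
    apply: iKD'; first exact: measurable_funrneg.
    move=> x; rewrite ger0_norm ?funrneg_ge0// /funrneg.
    by rewrite ge_max normr_ge0 -normrN ler_norm.
  split; first exact: iKD'.
  transitivity (\int[P]_x ((K x * D^\+ x)%:E - (K x * D^\- x)%:E))%E.
    by apply: eq_integral => x _; rewrite -EFinB -mulrBr funrposB.
  rewrite integralB// eqH//; last by move=> x; have /andP[] := K0 x.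
  by rewrite subee//; exact: integrable_fin_num inn.
have [|p1 p2] := sub (H^\+) (measurable_funrpos mH).
  by move=> x; rewrite funrpos_ge0/= /funrpos ge_max normr_ge0 ler_norm.
have [|n1 n2] := sub (H^\-) (measurable_funrneg mH).
  by move=> x; rewrite funrneg_ge0/= /funrneg ge_max normr_ge0 -normrN ler_norm.
transitivity (\int[P]_x ((H^\+ x * D x)%:E - (H^\- x * D x)%:E))%E.
  by apply: eq_integral => x _; rewrite -EFinB -mulrBl funrposB.
by rewrite integralB// p2 n2 sube0.
Qed.

(* Testing against the indicator of [u > v]. *)
Lemma sub_le_ae f g :
  measurable_fun [set: g_sigma_algebraType G] f ->
  measurable_fun [set: g_sigma_algebraType G] g ->
  P.-integrable setT (EFin \o f) -> P.-integrable setT (EFin \o g) ->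
  (forall A, <<s G >> A ->
    \int[P]_(x in A) (f x)%:E <= \int[P]_(x in A) (g x)%:E)%E ->
  {ae P, forall x, f x <= g x}.
Proof.
move=> mf mg If Ig fg.
pose A := [set x | g x < f x].
have GA : <<s G >> A.
  have := measurable_fun_ltr mg mf; move=> /(_ measurableT [set true]).
  by rewrite setTI; exact.
have mA := sG GA.
have Ifg : P.-integrable setT (EFin \o (fun x => f x - g x)) by exact: (integrableB measurableT If Ig).
have IA := integrableS measurableT mA (@subsetT _ _) Ifg.
have : (\int[P]_(x in A) `|(f x - g x)%:E| = 0)%E.
  apply/eqP; rewrite eq_le integral_ge0// andbT.
  have -> : (\int[P]_(x in A) `|(f x - g x)%:E| = \int[P]_(x in A) (f x - g x)%:E)%E.
    by apply: eq_integral => x; rewrite inE /A/= => gf; rewrite ger0_norm ?subr_ge0 ?ltW.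
  have IfA := integrableS measurableT mA (@subsetT _ _) If.
  have IgA := integrableS measurableT mA (@subsetT _ _) Ig.
  under eq_integral do rewrite EFinB.
  rewrite integralB// leeBlDr ?add0e; [exact: fg|exact: integrable_fin_num IgA].
move/(ae_eq_integral_abs P mA (measurable_int P IA)).
apply: filterS => x /= Ax; rewrite leNgt; apply/negP => xA.
by have [/eqP] := Ax xA; rewrite subr_eq0 gt_eqF.
Qed.

Lemma sub_eq_ae f g :
  measurable_fun [set: g_sigma_algebraType G] f ->
  measurable_fun [set: g_sigma_algebraType G] g ->
  P.-integrable setT (EFin \o f) -> P.-integrable setT (EFin \o g) ->
  (forall A, <<s G >> A ->
    \int[P]_(x in A) (f x)%:E = \int[P]_(x in A) (g x)%:E)%E ->
  {ae P, forall x, f x = g x}.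
Proof.
move=> mf mg If Ig fg.
have := sub_le_ae mf mg If Ig; have := sub_le_ae mg mf Ig If.
have fgle A : <<s G >> A -> (\int[P]_(x in A) (f x)%:E <= \int[P]_(x in A) (g x)%:E)%E.
  by move=> /fg ->.
have gfle A : <<s G >> A -> (\int[P]_(x in A) (g x)%:E <= \int[P]_(x in A) (f x)%:E)%E.
  by move=> /fg ->.
move=> /(_ gfle) H1 /(_ fgle) H2; apply: filterS2 H1 H2 => x h1 h2.
by apply/eqP; rewrite eq_le h1 h2.
Qed.

(** Used mostly with one of [f], [g] a version of the conditional expectation of the other: the
    pull-out property in integrated form. *)
Lemma integral_mul_eq f g H :
  P.-integrable setT (EFin \o f) -> P.-integrable setT (EFin \o g) ->
  measurable_fun [set: g_sigma_algebraType G] H ->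
  P.-integrable setT (EFin \o (fun x => H x * f x)) ->
  P.-integrable setT (EFin \o (fun x => H x * g x)) ->
  (forall A, <<s G >> A ->
    \int[P]_(x in A) (f x)%:E = \int[P]_(x in A) (g x)%:E)%E ->
  (\int[P]_x (H x * f x)%:E = \int[P]_x (H x * g x)%:E)%E.
Proof.
move=> If Ig mH IHf IHg fg.
have : (\int[P]_x (H x * (f x - g x))%:E = 0)%E.
  apply: integral_mul_eq0 => //.
  - exact: (integrableB measurableT If Ig).
  - have := integrableB measurableT IHf IHg; apply: eq_integrable => // x _.
    by rewrite /= -EFinB mulrBr.
  - move=> A /[dup] /sG mA /fg fgA.
    have IfA := integrableS measurableT mA (@subsetT _ _) If.
    have IgA := integrableS measurableT mA (@subsetT _ _) Ig.
    under eq_integral do rewrite EFinB.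
    by rewrite integralB// fgA subee//; exact: integrable_fin_num IgA.
under eq_integral do rewrite mulrBr EFinB.
rewrite integralB//.
have fp := integrable_fin_num measurableT IHf.
have fn := integrable_fin_num measurableT IHg.
rewrite -(fineK fp) -(fineK fn) -EFinB => -[] /eqP.
by rewrite subr_eq0 => /eqP ->.
Qed.

End sub_sigma_algebra.

(** * Square integrable functions and almost sure comparison *)

Section square_integrable.
Context d (T : measurableType d) (R : realType) (P : probability T R).
Implicit Types f g h : T -> R.

Definition sqi f := measurable_fun setT f /\
  P.-integrable setT (EFin \o (fun x => f x ^+ 2)).

Lemma integrable_bounded_mul f h (M : R) :
  P.-integrable setT (EFin \o f) -> measurable_fun setT h ->
  (forall x, `|h x| <= M) -> P.-integrable setT (EFin \o (fun x => h x * f x)).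
Proof.
move=> If mh hM.
have mf : measurable_fun setT f by apply/measurable_EFinP; exact: measurable_int If.
have IM := integrableZl measurableT `|M| If.
apply: le_integrable IM => //.
  by apply/measurable_EFinP; exact: measurable_funM.
move=> x _; rewrite /= lee_fin !normrM ler_wpM2r// normr_id.
exact: le_trans (hM x) (ler_norm _).
Qed.

Lemma integrable_bounded h (M : R) : measurable_fun setT h ->
  (forall x, `|h x| <= M) -> P.-integrable setT (EFin \o h).
Proof.
move=> mh hM.
have := integrable_bounded_mul (finite_measure_integrable_cst P 1 measurableT) mh hM.
by apply: eq_integrable => // x _; rewrite /= mulr1.
Qed.

Lemma sqi_mul f g : sqi f -> sqi g -> P.-integrable setT (EFin \o (fun x => f x * g x)).
Proof.
move=> [mf If] [mg Ig].
apply: le_integrable (integrableD measurableT If Ig) => //.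
  by apply/measurable_EFinP; exact: measurable_funM.
move=> x _; rewrite /= lee_fin normrM [leRHS]ger0_norm ?addr_ge0 ?sqr_ge0//.
rewrite -(real_normK (num_real (f x))) -(real_normK (num_real (g x))).
have := sqr_ge0 (`|f x| - `|g x|); have := normr_ge0 (f x); have := normr_ge0 (g x).
by nra.
Qed.

Lemma sqi_bounded h (M : R) : measurable_fun setT h -> (forall x, `|h x| <= M) -> sqi h.
Proof.
move=> mh hM; split=> //.
apply: (@integrable_bounded _ (M ^+ 2)); first exact: measurable_funX.
by move=> x; rewrite normrX lerXn2r// nnegrE// (le_trans _ (hM x)).
Qed.

Lemma sqi_integrable f : sqi f -> P.-integrable setT (EFin \o f).
Proof.
move=> sf; have s1 : sqi (cst 1).
  by apply: (@sqi_bounded _ 1) => // x; rewrite normr1.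
by have := sqi_mul sf s1; apply: eq_integrable => // x _; rewrite /= mulr1.
Qed.

Lemma sqi_bounded_mul h f (M : R) : measurable_fun setT h -> (forall x, `|h x| <= M) ->
  sqi f -> sqi (fun x => h x * f x).
Proof.
move=> mh hM [mf If]; split; first exact: measurable_funM.
have := @integrable_bounded_mul _ (fun x => h x ^+ 2) (M ^+ 2) If.
move=> /(_ (measurable_funX _ mh)) I2.
have : P.-integrable setT (EFin \o (fun x => h x ^+ 2 * f x ^+ 2)).
  by apply: I2 => x; rewrite normrX lerXn2r// nnegrE// (le_trans _ (hM x)).
by apply: eq_integrable => // x _; rewrite /= exprMn.
Qed.

Lemma sqiD f g : sqi f -> sqi g -> sqi (fun x => f x + g x).
Proof.
move=> sf sg; have [mf If] := sf; have [mg Ig] := sg.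
split; first exact: measurable_funD.
have Ifg := sqi_mul sf sg.
have := integrableD measurableT (integrableD measurableT (integrableD measurableT If Ig) Ifg) Ifg.
by apply: eq_integrable => // x _; rewrite /= -!EFinD; congr _%:E; ring.
Qed.

Lemma sqi0 : sqi (cst 0).
Proof. by apply: (@sqi_bounded _ 0) => // x; rewrite normr0. Qed.

Lemma sqi_sum I (r : seq I) (Q : pred I) (F : I -> T -> R) :
  (forall i, Q i -> sqi (F i)) -> sqi (fun x => \sum_(i <- r | Q i) F i x).
Proof.
move=> sF; elim: r => [|i r IH].
  by under eq_fun do rewrite big_nil; exact: sqi0.
under eq_fun do rewrite big_cons.
by case: (boolP (Q i)) => [Qi|_] //; apply: sqiD => //; exact: sF.
Qed.

(** The minimum of [f] and [g] equals [f] almost surely and lies below [g] everywhere, so the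
    pointwise comparison of integrals applies to it. *)
Lemma ae_le_integral f g A : measurable A ->
  P.-integrable setT (EFin \o f) -> P.-integrable setT (EFin \o g) ->
  {ae P, forall x, f x <= g x} ->
  (\int[P]_(x in A) (f x)%:E <= \int[P]_(x in A) (g x)%:E)%E.
Proof.
move=> mA If Ig fg.
have mf : measurable_fun setT f by apply/measurable_EFinP; exact: measurable_int If.
have mg : measurable_fun setT g by apply/measurable_EFinP; exact: measurable_int Ig.
have mm : measurable_fun setT (fun x => Num.min (f x) (g x)) by exact: measurable_minr.
have Im : P.-integrable setT (EFin \o (fun x => Num.min (f x) (g x))).
  have := integrableD measurableT (integrable_norm If) (integrable_norm Ig).
  apply: le_integrable => //; first exact/measurable_EFinP.
  move=> x _; rewrite /= lee_fin [leRHS]ger0_norm ?addr_ge0// minEle.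
  by case: ifP => _; [rewrite lerDl|rewrite lerDr].
have -> : (\int[P]_(x in A) (f x)%:E = \int[P]_(x in A) (Num.min (f x) (g x))%:E)%E.
  apply: ae_eq_integral => //.
  - by apply: measurable_funTS; exact: measurableT_comp.
  - by apply: measurable_funTS; exact: measurableT_comp.
  - by apply: filterS fg => x fgx _; rewrite (min_idPl fgx).
apply: le_integral => //.
- exact: (integrableS measurableT mA (@subsetT _ _) Im).
- exact: (integrableS measurableT mA (@subsetT _ _) Ig).
- by move=> x _; rewrite lee_fin ge_min lexx orbT.
Qed.

Lemma ae_eq_integrable f g : measurable_fun setT f -> {ae P, forall x, f x = g x} ->
  P.-integrable setT (EFin \o g) -> P.-integrable setT (EFin \o f).
Proof.
move=> mf fg Ig; have mg := measurable_int P Ig; have /integrableP[_] := Ig.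
move=> Ig'; apply/integrableP; split; first exact/measurable_EFinP.
have e : ae_eq P setT (abse \o (EFin \o f)) (abse \o (EFin \o g)).
  by apply: filterS fg => x fgx _ /=; rewrite fgx.
have mF : measurable_fun setT (abse \o (EFin \o f)).
  by apply: measurableT_comp => //; exact/measurable_EFinP.
have mF' : measurable_fun setT (abse \o (EFin \o g)) by exact: measurableT_comp.
have -> // := ge0_ae_eq_integral measurableT mF mF' (fun x _ => abse_ge0 _) (fun x _ => abse_ge0 _) e.
Qed.

End square_integrable.

Section conditional_expectation_facts.
Context d (T : measurableType d) (R : realType) (P : probability T R).
Variables (G : set (set T)) (mG : forall A, G A -> measurable A).
Implicit Types f g : T -> R.

Lemma sub_sigma_measurable A : <<s G >> A -> measurable A.
Proof.
move: A; apply: smallest_sub; first exact: sigma_algebra_measurable.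
by move=> A /mG.
Qed.

Lemma condE_unique f g : P.-integrable setT (EFin \o f) -> is_condE P G f g ->
  {ae P, forall x, condE P G f x = g x}.
Proof.
move=> If [_ mg Ig gf]; have [_ mc Ic cf] := condE_version mG If.
apply: (sub_eq_ae sub_sigma_measurable mc mg Ic Ig) => A GA.
by rewrite cf// gf.
Qed.

Lemma condE_le f g : P.-integrable setT (EFin \o f) -> P.-integrable setT (EFin \o g) ->
  (forall x, f x <= g x) -> {ae P, forall x, condE P G f x <= condE P G g x}.
Proof.
move=> If Ig fg; have [_ mf If' cf] := condE_version mG If.
have [_ mg Ig' cg] := condE_version mG Ig.
apply: (sub_le_ae sub_sigma_measurable mf mg If' Ig') => A GA.
have mA := sub_sigma_measurable GA.
rewrite cf// cg//; apply: le_integral => //.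
- exact: (integrableS measurableT mA (@subsetT _ _) If).
- exact: (integrableS measurableT mA (@subsetT _ _) Ig).
- by move=> x _; rewrite lee_fin.
Qed.

Lemma condE_ae_eq f g : measurable_fun setT f -> {ae P, forall x, f x = g x} ->
  P.-integrable setT (EFin \o g) -> {ae P, forall x, condE P G f x = condE P G g x}.
Proof.
move=> mf fg Ig; have If := ae_eq_integrable mf fg Ig.
apply: condE_unique => //; have [_ mc Ic cg] := condE_version mG Ig.
split=> // A GA; have mA := sub_sigma_measurable GA; rewrite cg//.
apply: ae_eq_integral => //.
- by apply: measurable_funTS; apply: (measurable_int _ Ig).
- by apply: measurable_funTS; apply: (measurable_int _ If).
- by apply: filterS fg => x fgx _; rewrite fgx.
Qed.

Lemma condE_cst (c : R) : {ae P, forall x, condE P G (cst c) x = c}.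
Proof.
have Ic := finite_measure_integrable_cst P c measurableT.
by apply: condE_unique => //; split.
Qed.

Lemma integral_condE f A : P.-integrable setT (EFin \o f) -> <<s G >> A ->
  (\int[P]_(x in A) (condE P G f x)%:E = \int[P]_(x in A) (f x)%:E)%E.
Proof. by move=> If; have [_ _ _] := condE_version mG If; exact. Qed.

Lemma measurable_condE f : P.-integrable setT (EFin \o f) ->
  measurable_fun [set: g_sigma_algebraType G] (condE P G f).
Proof. by move=> If; have [] := condE_version mG If. Qed.

Lemma integrable_condE f : P.-integrable setT (EFin \o f) ->
  P.-integrable setT (EFin \o condE P G f).
Proof. by move=> If; have [] := condE_version mG If. Qed.

End conditional_expectation_facts.

(** * Martingale transforms *)

Section martingale_transform.
Context d (T : measurableType d) (R : realType) (P : probability T R).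
Variables (n : nat) (G : 'I_n -> set (set T)).
Hypothesis sG : forall s A, <<s G s >> A -> measurable A.
Hypothesis homoG : forall s t : 'I_n, (s <= t)%N -> forall A, <<s G s >> A -> <<s G t >> A.
Variables (D H : 'I_n -> T -> R) (C : R).
Hypothesis C_ge0 : 0 <= C.
Hypothesis sqiD : forall s, sqi P (D s).
Hypothesis D_mean0 : forall s A, <<s G s >> A -> (\int[P]_(x in A) (D s x)%:E = 0)%E.
Hypothesis D_var : forall s A, <<s G s >> A ->
  (\int[P]_(x in A) (D s x ^+ 2)%:E <= \int[P]_(x in A) C%:E)%E.
Hypothesis adaptedD : forall s t : 'I_n, (s < t)%N ->
  measurable_fun [set: g_sigma_algebraType (G t)] (D s).
Hypothesis predictableH : forall s, measurable_fun [set: g_sigma_algebraType (G s)] (H s).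
Hypothesis sqiH : forall s, sqi P (H s).

Let a s x := H s x * D s x.

(** [D_var] bounds the conditional second moment of [D s] by [C] in integrated form; the nonnegative
    multiplier [H s x ^+ 2] is measurable for [G s], so [le_integral_mul] inserts it on both
    sides. *)
Lemma martingale_increment_le s :
  (\int[P]_x (a s x ^+ 2)%:E <= C%:E * \int[P]_x (H s x ^+ 2)%:E)%E.
Proof.
have [mH iH2] := sqiH s; have [mD _] := sqiD s.
rewrite -ge0_integralZl ?lee_fin//; last 2 first.
- by apply: measurableT_comp => //; exact: measurable_funX.
- by move=> x _; rewrite lee_fin sqr_ge0.
rewrite /a; under [leLHS]eq_integral do rewrite exprMn.
under [leRHS]eq_integral do rewrite -EFinM mulrC.
apply: (le_integral_mul (sG (s := s))) => //.
- exact: measurable_funX.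
- by move=> x; exact: sqr_ge0.
- exact: measurable_funX.
- by move=> x; exact: sqr_ge0.
- exact: D_var.
Qed.

(** A product of two square integrable functions need not be square integrable; here the preceding
    bound makes it so. *)
Lemma sqi_martingale_increment s : sqi P (a s).
Proof.
have [mH iH2] := sqiH s; have [mD _] := sqiD s.
split; first exact: measurable_funM.
apply/integrableP; split.
  by apply: measurableT_comp => //; apply: measurable_funX; exact: measurable_funM.
under eq_integral do rewrite /= ger0_norm ?sqr_ge0//.
apply: le_lt_trans (martingale_increment_le s) _.
apply: lte_mul_pinfty => //; rewrite -ge0_fin_numE; first exact: integrable_fin_num iH2.
by apply: integral_ge0 => x _; rewrite lee_fin sqr_ge0.
Qed.

(** For s < t everything except [D t] is measurable for [G t], and [D t] integrates to zero against
    such multipliers. *)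
Lemma martingale_orthogonal (s t : 'I_n) : s != t ->
  (\int[P]_x (a s x * a t x)%:E = 0)%E.
Proof.
wlog st : s t / (s < t)%N.
  move=> wl; rewrite neq_ltn => /orP[st|ts]; first by apply: wl => //; rewrite neq_ltn st.
  by under eq_integral do rewrite mulrC; apply: wl => //; rewrite neq_ltn ts.
move=> _; rewrite /a; under eq_integral do rewrite mulrA.
apply: (integral_mul_eq0 (sG (s := t))).
- exact: sqi_integrable.
- apply: measurable_funM => //; apply: measurable_funM; last exact: adaptedD.
  by move=> _ B mB; apply: (homoG (ltnW st)); exact: (predictableH measurableT mB).
- have := sqi_mul (sqi_martingale_increment s) (sqi_martingale_increment t).
  by apply: eq_integrable => // x _; rewrite /= mulrA.
- by move=> A; exact: D_mean0.
Qed.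

Lemma sqi_martingale_transform : sqi P (fun x => \sum_s H s x * D s x).
Proof. by apply: sqi_sum => s _; exact: sqi_martingale_increment. Qed.

Lemma integral_martingale_transform_sqr :
  (\int[P]_x ((\sum_s H s x * D s x) ^+ 2)%:E <=
   C%:E * \sum_s \int[P]_x (H s x ^+ 2)%:E)%E.
Proof.
have Iab s t : P.-integrable setT (fun x => (a s x * a t x)%:E).
  exact: sqi_mul (sqi_martingale_increment s) (sqi_martingale_increment t).
have -> : (\int[P]_x ((\sum_s H s x * D s x) ^+ 2)%:E =
    \int[P]_x \sum_s \sum_t (a s x * a t x)%:E)%E.
  apply: eq_integral => x _; rewrite expr2 mulr_suml -sumEFin; apply: eq_bigr => s _.
  by rewrite mulr_sumr -sumEFin.
rewrite integral_sum//; last by move=> s; apply: integrable_sum => // t _; exact: Iab.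
rewrite (eq_bigr (fun s => \sum_t \int[P]_x (a s x * a t x)%:E)%E) => [|s _]; last first.
  by rewrite integral_sum// => t; exact: Iab.
rewrite ge0_sume_distrr; last by move=> s _; apply: integral_ge0 => x _; rewrite lee_fin sqr_ge0.
apply: lee_sum => s _; rewrite (bigD1 s)//= big1 => [|t ts].
  rewrite adde0; under eq_integral do rewrite -expr2.
  exact: martingale_increment_le.
by rewrite martingale_orthogonal// eq_sym.
Qed.

End martingale_transform.

(** * Conditional independence *)

Section conditional_independence.
Context d (T : measurableType d) (R : realType) (P : probability T R).
Variables (G : set (set T)) (mG : forall A, G A -> measurable A).
Variables (n : nat) (X : 'I_n -> {RV P >-> R}).
Hypothesis X_indep : cond_independent G X.

Let sG := sub_sigma_measurable mG.

(* A pi-system generating the sigma-algebra of G and the X t with t < s. *)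
Definition past (s : nat) : set (set T) :=
  [set C | exists A (B : 'I_n -> set R), [/\ <<s G >> A,
    (forall t, measurable (B t)), (forall t : 'I_n, (s <= t)%N -> B t = setT) &
    C = A `&` \bigcap_(t in [set: 'I_n]) (X t @^-1` B t)]].

Lemma measurable_preimages (B : 'I_n -> set R) : (forall t, measurable (B t)) ->
  measurable (\bigcap_(t in [set: 'I_n]) (X t @^-1` B t)).
Proof.
move=> mB; apply: fin_bigcap_measurable => // t _; rewrite -[X in measurable X]setTI.
exact: (measurable_funP (X t)).
Qed.

Lemma past_measurable s C : past s C -> measurable C.
Proof.
move=> [A [B [GA mB _ ->]]]; apply: measurableI; first exact: sG.
exact: measurable_preimages.
Qed.

Lemma past_sigma s : forall C, <<s past s >> C -> measurable C.
Proof. by move=> C; apply: sub_sigma_measurable; exact: past_measurable. Qed.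

Lemma past_setI s : setI_closed (past s).
Proof.
move=> _ _ [A1 [B1 [GA1 mB1 e1 ->]]] [A2 [B2 [GA2 mB2 e2 ->]]].
exists (A1 `&` A2), (fun t => B1 t `&` B2 t); split.
- have := @measurableI _ (g_sigma_algebraType G) A1 A2; exact.
- by move=> t; exact: measurableI.
- by move=> t st; rewrite e1// e2// setTI.
- by rewrite bigcapI setIACA.
Qed.

Lemma past_homo s s' : (s <= s')%N -> forall A, <<s past s >> A -> <<s past s' >> A.
Proof.
move=> ss'; apply: smallest_sub; first exact: smallest_sigma_algebra.
move=> C [A [B [GA mB e ->]]]; apply: sub_sigma_algebra.
by exists A, B; split=> // t s't; apply: e; exact: leq_trans s't.
Qed.

Lemma sub_past s A : <<s G >> A -> <<s past s >> A.
Proof.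
move=> GA; apply: sub_sigma_algebra; exists A, (fun=> setT); split=> //.
by rewrite (_ : \bigcap_(t in _) _ = setT) ?setIT// bigcapT.
Qed.

Lemma measurable_past_G s d' (U : measurableType d') (f : T -> U) :
  measurable_fun [set: g_sigma_algebraType G] f ->
  measurable_fun [set: g_sigma_algebraType (past s)] f.
Proof. by move=> mf _ B mB; apply: sub_past; exact: (mf measurableT B mB). Qed.

Lemma measurable_past_X (s : nat) (t : 'I_n) : (t < s)%N ->
  measurable_fun [set: g_sigma_algebraType (past s)] (X t).
Proof.
move=> ts _ B mB; rewrite setTI; apply: sub_sigma_algebra.
exists setT, (fun u => if u == t then B else setT); split.
- exact: (@measurableT _ (g_sigma_algebraType G)).
- by move=> u; case: ifP.
- by move=> u su; case: eqP => // eut; move: ts; rewrite -eut ltnNge su.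
- rewrite setTI; apply/seteqP; split=> [x Bx u _ /=|x /(_ t I)/=]; last by rewrite eqxx.
  by case: eqP => // ->.
Qed.

Lemma condP_setT : {ae P, forall x, condP P G setT x = 1}.
Proof. by rewrite /condP indicT; exact: condE_cst. Qed.

Lemma integrable_indicator (A : set T) : measurable A -> P.-integrable setT (EFin \o (\1_A : T -> R)).
Proof.
move=> mA; apply: (@integrable_bounded _ _ _ _ _ 1); first exact: measurable_indic.
by move=> x; rewrite indicE ger0_norm// lern1 leq_b1.
Qed.

(** The slot [s] of [B] is free, so placing [E] there gives another rectangle. The product formulas
    of the two rectangles differ only in the factor at [s], which is 1 for the full line. *)
Lemma condP_prod (s : 'I_n) (B : 'I_n -> set R) (E : set R) :
  (forall t, measurable (B t)) -> B s = setT -> measurable E ->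
  {ae P, forall x,
    condP P G (X s @^-1` E `&` \bigcap_(t in [set: 'I_n]) (X t @^-1` B t)) x =
    condP P G (X s @^-1` E) x * condP P G (\bigcap_(t in [set: 'I_n]) (X t @^-1` B t)) x}.
Proof.
move=> mB Bs mE.
pose B' t := if t == s then E else B t.
have mB' t : measurable (B' t) by rewrite /B'; case: ifP.
have -> : X s @^-1` E `&` \bigcap_(t in [set: 'I_n]) (X t @^-1` B t) =
    \bigcap_(t in [set: 'I_n]) (X t @^-1` B' t).
  rewrite /B'; apply/seteqP; split=> [x [Ex Bx] t _ /=|x Bx].
    by case: eqP => [->//|_]; exact: Bx.
  split; first by have := Bx s I; rewrite /= eqxx.
  by move=> t _; have := Bx t I; rewrite /=; case: eqP => // -> _; rewrite Bs.
have := condP_setT; have := X_indep mB; have := X_indep mB'.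
apply: filterS3 => x -> -> c1.
rewrite (bigD1 s)//= [in RHS](bigD1 s)//= /B' eqxx Bs preimage_setT c1 mul1r; congr (_ * _).
by apply: eq_bigr => t /negbTE ->.
Qed.

(** The past shifters add nothing to what F_0 says about X_s. The difference of the two sides is a
    charge in [C]; it vanishes on the pi-system [past s], hence on the sigma-algebra generated by
    it. Leaving [phi] free covers the identity, the power [2 + nu] and the truncated square. *)
Lemma integral_past (s : 'I_n) (phi : R -> R) (C : set T) :
  measurable_fun setT phi ->
  P.-integrable setT (EFin \o (phi \o X s)) ->
  <<s past s >> C ->
  (\int[P]_(x in C) (phi (X s x))%:E = \int[P]_(x in C) (condE P G (phi \o X s) x)%:E)%E.
Proof.
move=> mphi Iphi.
pose c := condE P G (phi \o X s).
have mc : measurable_fun [set: g_sigma_algebraType G] c by exact: measurable_condE.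
have Ic : P.-integrable setT (EFin \o c) by exact: integrable_condE.
have mcT : measurable_fun setT c by exact: sub_measurable_fun mc.
have mXT : measurable_fun setT (phi \o X s) by exact: measurableT_comp.
have ID : P.-integrable setT (EFin \o (fun x => phi (X s x) - c x)).
  exact: (integrableB measurableT Iphi Ic).
(* Closure under complements rests on [nuT], the identity on the whole space; closure under disjoint
   unions is the additivity of the charge. *)
have dynk : lambda_system setT [set C | measurable C /\
    (induced_charge ID C = 0)%E].
  have nuT : (induced_charge ID setT = 0)%E.
    have := integral_condE mG Iphi (@measurableT _ (g_sigma_algebraType G)).
    have IcT := integrable_fin_num measurableT Ic.
    rewrite /induced_charge /= => e; under eq_integral do rewrite EFinB.
    by rewrite integralB// -e subee.
  apply/dynkin_lambda_system; split.
  - by split; first exact: measurableT.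
  - move=> A [mA A0]; split; first exact: measurableC.
    have := chargeD (induced_charge ID) (@measurableT _ T) mA.
    by rewrite setTD setTI => /= ->; rewrite nuT A0 sube0.
  - move=> F tF mF; split; first by apply: bigcupT_measurable => i; have [] := mF i.
    have mFi i : measurable (F i) by have [] := mF i.
    have := @charge_semi_sigma_additive _ _ _ (induced_charge ID) F mFi tF (bigcupT_measurable _ mFi).
    under eq_fun do (rewrite big1; last by move=> i _; have [] := mF i).
    by move=> F0; apply/esym; apply: (cvg_unique _ (cvg_cst 0%E) F0).
have base C' : past s C' -> measurable C' /\ induced_charge ID C' = 0%E.
  move=> pC; split; first exact: past_measurable pC.
  have [A [B [GA mB /(_ s (leqnn s)) Bs ->]]] := pC.
  set E := \bigcap_(t in _) _.
  have mE : measurable E by exact: measurable_preimages.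
  have mA := sG GA.
  (* Since [B s] is the full line, [Z] does not involve [X s]: conditional independence lets us
     replace [Z] by its conditional probability [z] when integrating against [phi (X s)]. The
     truncation to [0, 1] only changes [z] on a null set. *)
  pose Z : T -> R := \1_E.
  pose z x := Num.max 0 (Num.min 1 (condP P G E x)).
  have IZ : P.-integrable setT (EFin \o Z) by exact: integrable_indicator.
  have mz : measurable_fun [set: g_sigma_algebraType G] z.
    by apply: measurable_maxr => //; apply: measurable_minr => //; exact: measurable_condE.
  have mzT : measurable_fun setT z by exact: sub_measurable_fun mz.
  have z01 x : `|z x| <= 1.
    rewrite ger0_norm ?le_max ?lexx// /z ge_max ler01/=.
    by rewrite ge_min lexx.
  have Z01 x : `|Z x| <= 1 by rewrite /Z indicE ger0_norm// lern1 leq_b1.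
  have zP : {ae P, forall x, condP P G E x = z x}.
    have I0 : P.-integrable setT (EFin \o (cst 0 : T -> R)).
      exact: finite_measure_integrable_cst.
    have I1 : P.-integrable setT (EFin \o (cst 1 : T -> R)).
      exact: finite_measure_integrable_cst.
    have h0 : {ae P, forall x, 0 <= condP P G E x}.
      have : {ae P, forall x, condE P G (cst 0) x <= condP P G E x}.
        by apply: condE_le => // x; rewrite /= indicE.
      by apply: filterS2 (condE_cst P mG 0) => x ->.
    have h1 : {ae P, forall x, condP P G E x <= 1}.
      have : {ae P, forall x, condP P G E x <= condE P G (cst 1) x}.
        by apply: condE_le => // x; rewrite /= indicE lern1 leq_b1.
      by apply: filterS2 (condE_cst P mG 1) => x ->.
    apply: filterS2 h0 h1 => x c0 c1.
    by rewrite /z (min_idPr c1) (max_idPr c0).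
  have IZz A' : <<s G >> A' -> (\int[P]_(x in A') (Z x)%:E = \int[P]_(x in A') (z x)%:E)%E.
    move=> GA'; rewrite -(integral_condE mG IZ GA').
    have mA' := sG GA'.
    apply: ae_eq_integral => //.
    - apply: measurable_funTS; apply: measurableT_comp => //.
      by apply: (sub_measurable_fun sG); exact: measurable_condE.
    - by apply: measurable_funTS; apply: measurableT_comp.
    - by apply: filterS zP => x; rewrite /condP => -> _.
  have mA1 : measurable_fun [set: g_sigma_algebraType G] (\1_A : T -> R).
    exact: (@measurable_indic _ (g_sigma_algebraType G)).
  have mA1T : measurable_fun setT (\1_A : T -> R) by exact: measurable_indic.
  have A01 x : `|\1_A x : R| <= 1 by rewrite indicE ger0_norm// lern1 leq_b1.
  have mZT : measurable_fun setT Z by exact: measurable_indic.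
  have AZ01 (f : T -> R) : (forall x, `|f x| <= 1) -> forall x, `|\1_A x * f x| <= 1.
    by move=> f1 x; rewrite normrM mulr_ile1.
  (* The roles are exchanged: [phi (X s x)] is the multiplier, measurable for the sigma-algebra of
     [X s] alone. It is thus enough to compare [\1_A * Z] and [\1_A * z] on the events defined by
     [X s], where [condP_prod] applies. *)
  have step1 : (\int[P]_x (phi (X s x) * (\1_A x * Z x))%:E =
                \int[P]_x (phi (X s x) * (\1_A x * z x))%:E)%E.
    pose G' : set (set T) := g_sigma_algebra_preimage (X s).
    have sG'E : <<s G' >> = G'.
      apply: sigma_algebra_id; apply: sigma_algebra_preimage.
      exact: sigma_algebra_measurable.
    have sG' A' : <<s G' >> A' -> measurable A'.
      by rewrite sG'E => -[B' mB' <-]; exact: (measurable_funP (X s)).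
    have mX' : measurable_fun [set: g_sigma_algebraType G'] (X s).
      by move=> _ B' mB'; apply: sub_sigma_algebra; exists B'.
    apply: (integral_mul_eq sG' (f := fun x => \1_A x * Z x) (g := fun x => \1_A x * z x)
      (H := phi \o X s)).
    - by apply: (@integrable_bounded _ _ _ _ _ 1); [exact: measurable_funM|exact: AZ01].
    - by apply: (@integrable_bounded _ _ _ _ _ 1); [exact: measurable_funM|exact: AZ01].
    - exact: (measurableT_comp mphi mX').
    - have := integrable_bounded_mul Iphi (measurable_funM mA1T mZT) (AZ01 _ Z01).
      by apply: eq_integrable => // x _; rewrite /= mulrC.
    - have := integrable_bounded_mul Iphi (measurable_funM mA1T mzT) (AZ01 _ z01).
      by apply: eq_integrable => // x _; rewrite /= mulrC.
    rewrite sG'E => _ [B' mB' <-]; rewrite setTI.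
    set F := X s @^-1` B'.
    have mF : measurable F by rewrite -[F]setTI; exact: (measurable_funP (X s)).
    have mFE : measurable (F `&` E) by exact: measurableI.
    have IF := integrable_indicator mF; have IFE := integrable_indicator mFE.
    transitivity (\int[P]_(x in A) (\1_(F `&` E) x)%:E)%E.
      rewrite [LHS]integral_mkcond [RHS]integral_mkcond; apply: eq_integral => x _.
      by rewrite !epatch_indic/= indicI/= -!EFinM; congr _%:E; rewrite /Z; ring.
    rewrite -(integral_condE mG IFE GA).
    have mcF : measurable_fun [set: g_sigma_algebraType G] (condP P G F) by exact: measurable_condE.
    have mcFT : measurable_fun setT (condP P G F) by exact: sub_measurable_fun mcF.
    transitivity (\int[P]_(x in A) (condP P G F x * z x)%:E)%E.
      apply: ae_eq_integral => //.
      - apply: measurable_funTS; apply: measurableT_comp => //.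
        by apply: (sub_measurable_fun sG); exact: measurable_condE.
      - apply: measurable_funTS; apply: measurableT_comp => //; exact: measurable_funM.
      - have := condP_prod mB Bs mB'.
        by apply: filterS2 zP => x + + _; rewrite -/E -/F /condP => zx ->; rewrite zx.
    transitivity (\int[P]_x (\1_A x * z x * condP P G F x)%:E)%E.
      rewrite [LHS]integral_mkcond; apply: eq_integral => x _.
      by rewrite !epatch_indic/= -!EFinM; congr _%:E; ring.
    transitivity (\int[P]_x (\1_A x * z x * \1_F x)%:E)%E.
      apply: (integral_mul_eq sG) => //.
      - exact: integrable_condE.
      - exact: measurable_funM.
      - exact: (integrable_bounded_mul (integrable_condE mG IF) (measurable_funM mA1T mzT) (AZ01 _ z01)).
      - exact: (integrable_bounded_mul IF (measurable_funM mA1T mzT) (AZ01 _ z01)).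
      - by move=> A' GA'; rewrite integral_condE.
    by rewrite [RHS]integral_mkcond; apply: eq_integral => x _; rewrite epatch_indic.
  (* Once [Z] has become the G-measurable [z], the factor [phi (X s x)] can be replaced by its
     conditional expectation [c]; [step3] then turns [z] back into [Z]. *)
  have step2 : (\int[P]_x (\1_A x * z x * phi (X s x))%:E =
                \int[P]_x (\1_A x * z x * c x)%:E)%E.
    apply: (integral_mul_eq sG) => //.
    - exact: measurable_funM.
    - by apply: (integrable_bounded_mul Iphi (M := 1)); [exact: measurable_funM|exact: AZ01].
    - by apply: (integrable_bounded_mul Ic (M := 1)); [exact: measurable_funM|exact: AZ01].
    - by move=> A' GA'; rewrite integral_condE.
  have step3 : (\int[P]_x (\1_A x * c x * Z x)%:E =
                \int[P]_x (\1_A x * c x * z x)%:E)%E.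
    have IAc : P.-integrable setT (EFin \o (fun x => \1_A x * c x)).
      by apply: (integrable_bounded_mul Ic (M := 1)).
    apply: (integral_mul_eq sG) => //.
    - exact: (@integrable_bounded _ _ _ _ _ 1).
    - exact: measurable_funM.
    - have := integrable_bounded_mul IAc mZT Z01.
      by apply: eq_integrable => // x _; rewrite /= mulrC.
    - have := integrable_bounded_mul IAc mzT z01.
      by apply: eq_integrable => // x _; rewrite /= mulrC.
  have AE (f : T -> R) : (\int[P]_(x in A `&` E) (f x)%:E = \int[P]_x (\1_A x * Z x * f x)%:E)%E.
    rewrite [LHS]integral_mkcond; apply: eq_integral => x _.
    by rewrite epatch_indic /= indicI /= -EFinM mulrC.
  rewrite /induced_charge /=; under eq_integral do rewrite EFinB.
  have mAE : measurable (A `&` E) by exact: measurableI.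
  have IcAE := integrableS measurableT mAE (@subsetT _ _) Ic.
  have IphiAE := integrableS measurableT mAE (@subsetT _ _) Iphi.
  rewrite integralB//.
  suff -> : (\int[P]_(x in A `&` E) (phi (X s x))%:E = \int[P]_(x in A `&` E) (c x)%:E)%E.
    by rewrite subee//; exact: integrable_fin_num IcAE.
  rewrite !AE.
  transitivity (\int[P]_x (\1_A x * z x * phi (X s x))%:E)%E.
    by under eq_integral do rewrite mulrC; rewrite step1; under eq_integral do rewrite mulrC.
  rewrite step2; under eq_integral do rewrite -mulrA [z _ * _]mulrC mulrA.
  by rewrite -step3; apply: eq_integral => x _; rewrite -mulrA [c _ * _]mulrC mulrA.
move=> pC.
have [mC C0] : measurable C /\ induced_charge ID C = 0%E.
  have := lambda_system_subset (past_setI (s := s)) dynk base; apply=> //.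
have IcC := integrableS measurableT mC (@subsetT _ _) Ic.
have IphiC := integrableS measurableT mC (@subsetT _ _) Iphi.
move: C0; rewrite /induced_charge /=; under eq_integral do rewrite EFinB.
rewrite integralB//.
have fp := integrable_fin_num mC IphiC; have fn := integrable_fin_num mC IcC.
rewrite -(fineK fp) -(fineK fn) -EFinB => -[] /eqP.
by rewrite subr_eq0 => /eqP ->.
Qed.

End conditional_independence.

Section bigop_facts.
Context (R : realType).

(** Each pair is attached to its larger index, so the coefficient of the shifter with that index
    involves earlier shifters only. *)
Lemma sum_offdiag n (f : 'I_n -> 'I_n -> R) :
  \sum_s \sum_(t | t != s) f s t =
  \sum_(s < n) \sum_(t < n) (t < s)%N%:R * (f s t + f t s).
Proof.
under [RHS]eq_bigr => s _ do under eq_bigr => t _ do rewrite mulrDr.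
under [RHS]eq_bigr => s _ do rewrite big_split/=.
rewrite big_split/= [X in _ + X]exchange_big/= -big_split/=.
apply: eq_bigr => s _; rewrite -big_split/= [LHS]big_mkcond; apply: eq_bigr => t _.
rewrite -val_eqE/=; case: ltngtP => _; rewrite ?mul0r ?mul1r ?addr0 ?add0r//.
Qed.

End bigop_facts.

(** * Moment bounds for forms in the shifters *)

Section shifters.
Context d (T : measurableType d) (R : realType) (P : probability T R).
Variables (G : set (set T)) (mG : forall A, G A -> measurable A).
Variables (n : nat) (X : 'I_n -> {RV P >-> R}).
Hypothesis X_indep : cond_independent G X.
Hypothesis X_mean0 : forall s, {ae P, forall x, condE P G (X s) x = 0}.
Variables (nu KX : R).
Hypothesis nu_gt0 : 0 < nu.
Hypothesis X_int : forall s, P.-integrable setT (EFin \o (fun x => `|X s x| `^ (2 + nu))).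
Hypothesis X_bound : forall s, {ae P, forall x, condE P G (fun y => `|X s y| `^ (2 + nu)) x <= KX}.

Let sG := sub_sigma_measurable mG.
Let Xp s x := `|X s x| `^ (2 + nu).

Lemma sqr_le_powR (u : R) : u ^+ 2 <= 1 + `|u| `^ (2 + nu).
Proof.
have [u1|u1] := leP `|u| 1.
  rewrite -(real_normK (num_real u)) ler_wpDr ?powR_ge0//.
  by rewrite expr_le1.
rewrite -(real_normK (num_real u)) ler_wpDl// -powR_mulrn//.
by apply: ler_powR; [exact: ltW|rewrite lerDl ltW].
Qed.

Lemma sqi_X s : sqi P (X s).
Proof.
split=> //; have I1 := finite_measure_integrable_cst P 1 measurableT.
apply: le_integrable (integrableD measurableT I1 (X_int s)) => //.
  by apply/measurable_EFinP; exact: measurable_funX.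
move=> x _; rewrite /= lee_fin [leLHS]ger0_norm ?sqr_ge0// [leRHS]ger0_norm ?addr_ge0 ?powR_ge0//.
exact: sqr_le_powR.
Qed.

Lemma X_integrable s : P.-integrable setT (EFin \o X s).
Proof. exact: sqi_integrable (sqi_X s). Qed.

Lemma X2_integrable s : P.-integrable setT (EFin \o (fun x => X s x ^+ 2)).
Proof. by have [] := sqi_X s. Qed.

(** As the conditional mean vanishes, this is the conditional variance up to a null set, without a
    version of the mean inside. *)
Definition sigma2 s := condE P G (fun x => X s x ^+ 2).

Lemma condVarE s : {ae P, forall x, condVar P G (X s) x = sigma2 s x}.
Proof.
have mc : measurable_fun setT (condE P G (X s)).
  by apply: (sub_measurable_fun sG); exact: measurable_condE (X_integrable s).
apply: condE_ae_eq => //; last exact: X2_integrable.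
  by apply: measurable_funX; exact: measurable_funB.
by apply: filterS (X_mean0 s) => x ->; rewrite subr0.
Qed.

Lemma measurable_powR_norm : measurable_fun setT (fun u : R => `|u| `^ (2 + nu)).
Proof. by apply: (measurableT_comp (measurable_powR _)). Qed.

Lemma integral_past_powR_le (s : 'I_n) A : <<s past G X s >> A ->
  (\int[P]_(x in A) (Xp s x)%:E <= \int[P]_(x in A) `|KX|%:E)%E.
Proof.
move=> pA; have mA := past_sigma mG pA.
rewrite (integral_past mG X_indep measurable_powR_norm)//; last exact: X_int.
have Ic := integrable_condE mG (X_int s).
apply: ae_le_integral => //; first exact: finite_measure_integrable_cst.
by apply: filterS (X_bound s) => x /le_trans; apply; exact: ler_norm.
Qed.

Lemma X_past_mean0 (s : 'I_n) A : <<s past G X s >> A -> (\int[P]_(x in A) (X s x)%:E = 0)%E.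
Proof.
move=> pA; have mA := past_sigma mG pA.
rewrite (integral_past (phi := idfun) mG X_indep (@measurable_id _ _ _))//; last exact: X_integrable.
transitivity (\int[P]_(x in A) (cst 0 x))%E; last exact: integral0.
apply: ae_eq_integral => //.
  apply: measurable_funTS; apply: measurableT_comp => //.
  by apply: (sub_measurable_fun sG); exact: measurable_condE (X_integrable s).
by apply: filterS (X_mean0 s) => x + _; rewrite (_ : idfun \o X s = X s)// => ->.
Qed.

(** By [sqr_le_powR], a bound for the conditional second moments; the absolute value makes it
    nonnegative whatever the sign of [KX]. *)
Let C := 1 + `|KX|.

Lemma X_past_var (s : 'I_n) A : <<s past G X s >> A ->
  (\int[P]_(x in A) (X s x ^+ 2)%:E <= \int[P]_(x in A) C%:E)%E.
Proof.
move=> pA; have mA := past_sigma mG pA.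
have mp : measurable_fun setT (Xp s) by exact: (measurableT_comp measurable_powR_norm).
apply: (@le_trans _ _ (\int[P]_(x in A) (1%:E + (Xp s x)%:E))%E).
  apply: ge0_le_integral => //.
  - by move=> x _; rewrite lee_fin sqr_ge0.
  - by apply: measurable_funTS; apply: measurableT_comp => //; exact: measurable_funX.
  - by apply: measurable_funTS; apply: emeasurable_funD => //; exact: measurableT_comp.
  - by move=> x _; rewrite lee_fin sqr_le_powR.
rewrite ge0_integralD//; last 2 first.
- by move=> x _; rewrite lee_fin powR_ge0.
- by apply: measurable_funTS; exact: measurableT_comp.
under [leRHS]eq_integral do rewrite EFinD.
rewrite [leRHS]ge0_integralD//.
by apply: leeD2l; exact: integral_past_powR_le.
Qed.

Lemma sqi_predictable (H : 'I_n -> T -> R) :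
  (forall s : 'I_n, measurable_fun [set: g_sigma_algebraType (past G X s)] (H s)) ->
  (forall s, sqi P (H s)) ->
  sqi P (fun x => \sum_s H s x * X s x) /\
  (\int[P]_x ((\sum_s H s x * X s x) ^+ 2)%:E <= C%:E * \sum_s \int[P]_x (H s x ^+ 2)%:E)%E.
Proof.
move=> mH sH.
have C0 : 0 <= C by rewrite addr_ge0.
have sG' (s : 'I_n) A : <<s past G X s >> A -> measurable A by exact: past_sigma.
have hG (s t : 'I_n) : (s <= t)%N -> forall A, <<s past G X s >> A -> <<s past G X t >> A.
  exact: past_homo.
split.
  exact: (sqi_martingale_transform (G := fun s : 'I_n => past G X s) sG' C0 sqi_X X_past_var mH sH).
apply: (integral_martingale_transform_sqr (G := fun s : 'I_n => past G X s) sG' hG C0 sqi_X X_past_mean0 X_past_var _ mH sH).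
by move=> s t; exact: measurable_past_X.
Qed.

(** The indicator of [A] is absorbed into the coefficients, which stay predictable because every
    [past G X s] generates a sigma-algebra containing that of [G]. *)
Lemma predictable_mean0 (H : 'I_n -> T -> R) A :
  (forall s : 'I_n, measurable_fun [set: g_sigma_algebraType (past G X s)] (H s)) ->
  (forall s, sqi P (H s)) -> <<s G >> A ->
  (\int[P]_(x in A) (\sum_s H s x * X s x)%:E = 0)%E.
Proof.
move=> mH sH GA; have mA := sG GA.
have IHX s : P.-integrable setT (EFin \o (fun x => H s x * X s x)) by exact: sqi_mul (sqi_X s).
under eq_integral do rewrite -sumEFin.
rewrite integral_sum//; last by move=> s; exact: integrableS measurableT mA (@subsetT _ _) (IHX s).
rewrite big1// => s _; rewrite integral_mkcond.
rewrite (eq_integral (fun x => (\1_A x * H s x * X s x)%:E)) => [|x _]; last first.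
  by rewrite epatch_indic/= -EFinM; congr _%:E; ring.
have mA1 : measurable_fun setT (\1_A : T -> R) by exact: measurable_indic.
have sG' A' : <<s past G X s >> A' -> measurable A' by exact: past_sigma.
apply: (integral_mul_eq0 sG' (D := X s) (H := fun x => \1_A x * H s x)).
- exact: X_integrable.
- apply: measurable_funM => //; apply: measurable_past_G.
  exact: (@measurable_indic _ (g_sigma_algebraType G)).
- have := integrable_bounded_mul (M := 1) (IHX s) mA1.
  have h x : `|\1_A x : R| <= 1 by rewrite indicE ger0_norm// lern1 leq_b1.
  by move=> /(_ h); apply: eq_integrable => // x _; rewrite /= mulrA.
- by move=> A' pA'; exact: X_past_mean0.
Qed.

Lemma sqi_linear (H : 'I_n -> T -> R) :
  (forall s, measurable_fun [set: g_sigma_algebraType G] (H s)) ->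
  (forall s, sqi P (H s)) ->
  sqi P (fun x => \sum_s H s x * X s x) /\
  (\int[P]_x ((\sum_s H s x * X s x) ^+ 2)%:E <= C%:E * \sum_s \int[P]_x (H s x ^+ 2)%:E)%E.
Proof. by move=> mH sH; apply: sqi_predictable => // s; exact: measurable_past_G. Qed.

Section off_diagonal.
Variables (B : 'I_n -> 'I_n -> T -> R) (M : R).
Hypothesis mB : forall s t, measurable_fun [set: g_sigma_algebraType G] (B s t).
Hypothesis BM : forall s t x, `|B s t x| <= M.

(** The symmetrized coefficients, moved below the diagonal: [L s] involves only the [X t] with t <
    s, and the off-diagonal form is the martingale transform with predictable coefficients [L s]. *)
Let K (s t : 'I_n) x := (t < s)%N%:R * (B s t x + B t s x).
Let L s x := \sum_t K s t x * X t x.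

Let mK s t : measurable_fun [set: g_sigma_algebraType G] (K s t).
Proof. by apply: measurable_funM => //; exact: measurable_funD. Qed.

Let sqiK s t : sqi P (K s t).
Proof.
apply: (@sqi_bounded _ _ _ _ _ (M + M)); first exact: sub_measurable_fun (mK s t).
move=> x; rewrite normrM -[leRHS]mul1r ler_pM//.
  by rewrite normr_nat lern1 leq_b1.
by rewrite (le_trans (ler_normD _ _))// lerD.
Qed.

Let sqiL s : sqi P (L s).
Proof. by have [] := sqi_linear (mK s) (sqiK s). Qed.

Let mL (s : 'I_n) : measurable_fun [set: g_sigma_algebraType (past G X s)] (L s).
Proof.
apply: measurable_sum => t; have [ts|st] := ltnP t s.
  by apply: measurable_funM; [exact: measurable_past_G|exact: measurable_past_X].
rewrite (_ : (fun x => _) = cst 0); first exact: measurable_cst.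
by apply/funext => x; rewrite /K ltnNge st/= mul0r mul0r.
Qed.

Let offdiagE x : \sum_s \sum_(t | t != s) B s t x * X s x * X t x = \sum_s L s x * X s x.
Proof.
rewrite sum_offdiag; apply: eq_bigr => s _; rewrite /L mulr_suml.
by apply: eq_bigr => t _; rewrite /K; ring.
Qed.

Lemma sqi_offdiag : sqi P (fun x => \sum_s \sum_(t | t != s) B s t x * X s x * X t x).
Proof. by under eq_fun do rewrite offdiagE; have [] := sqi_predictable mL sqiL. Qed.

Lemma offdiag_mean0 A : <<s G >> A ->
  (\int[P]_(x in A) (\sum_s \sum_(t | t != s) B s t x * X s x * X t x)%:E = 0)%E.
Proof.
by move=> GA; under eq_integral do rewrite offdiagE; exact: predictable_mean0 mL sqiL GA.
Qed.

(** One factor [C] comes from the outer transform, one from the inner linear form [L s]. The 4 is a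
    2 from (u + v)^2 <= 2 (u^2 + v^2) and a 2 from each coefficient occurring in both orders of the
    pair. *)
Lemma integral_offdiag_sqr :
  (\int[P]_x ((\sum_s \sum_(t | t != s) B s t x * X s x * X t x) ^+ 2)%:E <=
   (4 * C ^+ 2)%:E * \sum_s \sum_t \int[P]_x (B s t x ^+ 2)%:E)%E.
Proof.
have C0 : 0 <= C by rewrite addr_ge0.
under eq_integral do rewrite offdiagE.
have [_ /le_trans] := sqi_predictable mL sqiL; apply.
have iB s t : (0 <= \int[P]_x (B s t x ^+ 2)%:E)%E by apply: integral_ge0 => x _; rewrite lee_fin sqr_ge0.
have mBT s t : measurable_fun setT (B s t) by exact: sub_measurable_fun (mB s t).
have mB2 s t : measurable_fun setT (fun x => (B s t x ^+ 2)%:E).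
  by apply: measurableT_comp => //; exact: measurable_funX.
have Kle s t : (\int[P]_x (K s t x ^+ 2)%:E <=
    2%:E * (\int[P]_x (B s t x ^+ 2)%:E + \int[P]_x (B t s x ^+ 2)%:E))%E.
  rewrite -ge0_integralD//; try by move=> x _; rewrite lee_fin sqr_ge0.
  rewrite -ge0_integralZl//; last 2 first.
  - exact: emeasurable_funD.
  - by move=> x _; rewrite adde_ge0// lee_fin sqr_ge0.
  apply: ge0_le_integral => //.
  - by move=> x _; rewrite lee_fin sqr_ge0.
  - by apply: measurableT_comp => //; apply: measurable_funX; have [] := sqiK s t.
  - by apply: emeasurable_funM => //; exact: emeasurable_funD.
  - move=> x _; rewrite -EFinD -EFinM lee_fin /K.
    have := sqr_ge0 (B s t x - B t s x).
    by case: (_ < _)%N; rewrite ?mul0r ?mul1r; nra.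
have Lle s : (\int[P]_x (L s x ^+ 2)%:E <=
    C%:E * \sum_t (2%:E * (\int[P]_x (B s t x ^+ 2)%:E + \int[P]_x (B t s x ^+ 2)%:E)))%E.
  have [_ /le_trans] := sqi_linear (mK s) (sqiK s); apply.
  by apply: lee_wpmul2l; [rewrite lee_fin|apply: lee_sum => t _].
apply: (@le_trans _ _ (C%:E * \sum_s
    (C%:E * \sum_t (2%:E * (\int[P]_x (B s t x ^+ 2)%:E + \int[P]_x (B t s x ^+ 2)%:E))))%E).
  by apply: lee_wpmul2l; [rewrite lee_fin|apply: lee_sum => s _].
have e (f : 'I_n -> 'I_n -> \bar R) : (forall s t, 0 <= f s t)%E ->
    (C%:E * \sum_s (C%:E * \sum_t (2%:E * (f s t + f t s))) =
     (4 * C ^+ 2)%:E * \sum_s \sum_t f s t)%E.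
  move=> f0.
  set S := (\sum_s \sum_t f s t)%E.
  have S0 : (0 <= S)%E by do 2 (apply: sume_ge0 => ? _).
  rewrite (eq_bigr (fun s => (C * 2)%:E * \sum_t (f s t + f t s))%E) => [|s _]; last first.
    by rewrite -ge0_sume_distrr ?EFinM ?muleA// => t _; rewrite adde_ge0.
  rewrite -ge0_sume_distrr => [|s _]; last by apply: sume_ge0 => t _; rewrite adde_ge0.
  rewrite (eq_bigr (fun s => \sum_t f s t + \sum_t f t s)%E) => [|s _]; last by rewrite big_split.
  rewrite big_split/= [X in (_ + X)%E]exchange_big/= -/S muleA -EFinM.
  have -> : (S + S = 2%:E * S)%E by rewrite -[in LHS](mul1e S) -ge0_muleDl// -EFinD.
  by rewrite muleA -EFinM; congr (_%:E * _)%E; ring.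
by rewrite e.
Qed.

End off_diagonal.

Section diagonal.
Variables (h : 'I_n -> T -> R) (M k : R).
Hypothesis mh : forall s, measurable_fun [set: g_sigma_algebraType G] (h s).
Hypothesis hM : forall s x, `|h s x| <= M.
Hypothesis k_gt0 : 0 < k.

Definition truncate (u : R) := Num.min (u ^+ 2) (k ^+ 2).

Lemma truncate_ge0 u : 0 <= truncate u.
Proof. by rewrite le_min !sqr_ge0. Qed.

Lemma truncate_le u : truncate u <= k ^+ 2.
Proof. by rewrite ge_min lexx orbT. Qed.

Lemma truncate_le_sqr u : truncate u <= u ^+ 2.
Proof. by rewrite ge_min lexx. Qed.

(** For |u| > k, u^2 = |u|^(-nu) |u|^(2 + nu) and the first factor is at most k^(-nu): the moment
    beyond order two buys a factor that vanishes as [k] grows. *)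
Lemma truncation_error_le u : u ^+ 2 - truncate u <= k `^ (- nu) * `|u| `^ (2 + nu).
Proof.
rewrite /truncate; have [uk|ku] := leP (u ^+ 2) (k ^+ 2).
  by rewrite subrr mulr_ge0// powR_ge0.
rewrite (@le_trans _ _ (u ^+ 2))// ?gerBl ?sqr_ge0//.
have u0 : 0 < `|u| by rewrite normr_gt0; apply: contraTneq ku => ->; rewrite expr0n/= -leNgt sqr_ge0.
rewrite powRD; last by rewrite (gt_eqF u0) implybT.
rewrite powR_mulrn// real_normK ?num_real// mulrCA ler_peMr ?sqr_ge0//.
rewrite powRN ler_pdivlMl ?powR_gt0// mulr1 ge0_ler_powR ?nnegrE ?ltW//.
by rewrite -(@ltr_pXn2r _ 2) ?nnegrE ?ltW// real_normK ?num_real.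
Qed.

Lemma measurable_truncate : measurable_fun setT truncate.
Proof. by apply: measurable_minr => //; exact: measurable_funX. Qed.

Let phi s := truncate \o X s.
Let g s := condE P G (phi s).

Let mphi s : measurable_fun setT (phi s).
Proof. by apply: measurableT_comp => //; exact: measurable_truncate. Qed.

Let Iphi s : P.-integrable setT (EFin \o phi s).
Proof.
apply: (@integrable_bounded _ _ _ _ _ (k ^+ 2)) => // x.
by rewrite ger0_norm ?truncate_ge0 ?truncate_le.
Qed.

Let mg s : measurable_fun [set: g_sigma_algebraType G] (g s).
Proof. exact: measurable_condE. Qed.

Let mgT s : measurable_fun setT (g s).
Proof. exact: sub_measurable_fun (mg s). Qed.

Let g_bound s : {ae P, forall x, 0 <= g s x <= k ^+ 2}.
Proof.
have I0 c := finite_measure_integrable_cst P c measurableT.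
have h0 : {ae P, forall x, 0 <= g s x}.
  have : {ae P, forall x, condE P G (cst 0) x <= g s x}.
    by apply: (condE_le mG (I0 0) (Iphi s)) => x; exact: truncate_ge0.
  by apply: filterS2 (condE_cst P mG 0) => x ->.
have h1 : {ae P, forall x, g s x <= k ^+ 2}.
  have : {ae P, forall x, g s x <= condE P G (cst (k ^+ 2)) x}.
    by apply: (condE_le mG (Iphi s) (I0 (k ^+ 2))) => x; exact: truncate_le.
  by apply: filterS2 (condE_cst P mG (k ^+ 2)) => x ->.
by apply: filterS2 h0 h1 => x -> ->.
Qed.

Definition truncated_innovation s x := truncate (X s x) - condE P G (truncate \o X s) x.

Definition tail_innovation s x :=
  X s x ^+ 2 - truncate (X s x) - (sigma2 s x - condE P G (truncate \o X s) x).

Let D := truncated_innovation.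

Let mD s : measurable_fun setT (D s).
Proof. exact: (measurable_funB (mphi s) (mgT s)). Qed.

Let D2le s : {ae P, forall x, D s x ^+ 2 <= k ^+ 4}.
Proof.
apply: filterS (g_bound s) => x /andP[]; rewrite /g /phi => g0 g1.
rewrite [k ^+ 4](exprM k 2 2).
rewrite -[leLHS](real_normK (num_real _)) lerXn2r// ?nnegrE ?sqr_ge0//.
have := truncate_ge0 (X s x); have := truncate_le (X s x).
by rewrite /D /truncated_innovation ler_norml; lra.
Qed.

Let sqiD s : sqi P (D s).
Proof.
(* The bound [k ^+ 4] holds only almost surely, since [condE] is an arbitrary version; the minimum
   is an everywhere bounded function equal to the square off a null set. *)
split=> //; apply: (ae_eq_integrable (g := fun x => Num.min (D s x ^+ 2) (k ^+ 4))).
- exact: measurable_funX.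
- by apply: filterS (D2le s) => x D2x; rewrite (min_idPl D2x).
- apply: (@integrable_bounded _ _ _ _ _ (k ^+ 4)).
    by apply: measurable_minr => //; exact: measurable_funX.
  by move=> x; rewrite ger0_norm ?ge_min ?lexx ?orbT// le_min sqr_ge0 exprn_ge0// ltW.
Qed.

Let hsqi s : sqi P (h s).
Proof. by apply: (@sqi_bounded _ _ _ _ _ M) => //; exact: sub_measurable_fun (mh s). Qed.

Lemma sqi_truncated : sqi P (fun x => \sum_s h s x * truncated_innovation s x) /\
  (\int[P]_x ((\sum_s h s x * truncated_innovation s x) ^+ 2)%:E <=
   (k ^+ 4)%:E * \sum_s \int[P]_x (h s x ^+ 2)%:E)%E.
Proof.
have k40 : 0 <= k ^+ 4 by rewrite exprn_ge0// ltW.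
have sG' (s : 'I_n) A : <<s past G X s >> A -> measurable A by exact: past_sigma.
have hG (s t : 'I_n) : (s <= t)%N -> forall A, <<s past G X s >> A -> <<s past G X t >> A.
  exact: past_homo.
have D0 (s : 'I_n) A : <<s past G X s >> A -> (\int[P]_(x in A) (D s x)%:E = 0)%E.
  move=> pA; have mA := past_sigma mG pA.
  rewrite /D /truncated_innovation; under eq_integral do rewrite EFinB.
  have IA := integrableS measurableT mA (@subsetT _ _) (Iphi s).
  have IcA := integrableS measurableT mA (@subsetT _ _) (integrable_condE mG (Iphi s)).
  rewrite integralB// (integral_past mG X_indep measurable_truncate (Iphi s) pA).
  by rewrite subee//; exact: integrable_fin_num IcA.
have D2 (s : 'I_n) A : <<s past G X s >> A ->
    (\int[P]_(x in A) (D s x ^+ 2)%:E <= \int[P]_(x in A) (k ^+ 4)%:E)%E.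
  move=> pA; apply: ae_le_integral => //; first exact: past_sigma pA.
  - by have [] := sqiD s.
  - exact: finite_measure_integrable_cst.
have mhp (s : 'I_n) : measurable_fun [set: g_sigma_algebraType (past G X s)] (h s).
  exact: measurable_past_G.
have aD (s t : 'I_n) : (s < t)%N -> measurable_fun [set: g_sigma_algebraType (past G X t)] (D s).
  move=> st.
  have m1 : measurable_fun [set: g_sigma_algebraType (past G X t)] (phi s).
    by apply: (measurableT_comp measurable_truncate); exact: measurable_past_X.
  have m2 : measurable_fun [set: g_sigma_algebraType (past G X t)] (g s).
    by apply: measurable_past_G; exact: mg.
  exact: (measurable_funB m1 m2).
split.
  exact: (sqi_martingale_transform (G := fun s : 'I_n => past G X s) sG' k40 sqiD D2 mhp hsqi).
exact: (integral_martingale_transform_sqr (G := fun s : 'I_n => past G X s)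
  sG' hG k40 sqiD D0 D2 aD mhp hsqi).
Qed.

Let rho s x := X s x ^+ 2 - truncate (X s x).
Let r s x := sigma2 s x - g s x.

Let mhT s : measurable_fun setT (h s).
Proof. exact: sub_measurable_fun (mh s). Qed.

Let Isigma s := integrable_condE mG (X2_integrable s).

Let Irho s : P.-integrable setT (EFin \o rho s).
Proof. exact: (integrableB measurableT (X2_integrable s) (Iphi s)). Qed.

Let Ir s : P.-integrable setT (EFin \o r s).
Proof. exact: (integrableB measurableT (Isigma s) (integrable_condE mG (Iphi s))). Qed.

Let mrho s : measurable_fun setT (rho s).
Proof. by apply: measurable_funB; [exact: measurable_funX|exact: mphi]. Qed.

Let mr s : measurable_fun [set: g_sigma_algebraType G] (r s).
Proof. exact: (measurable_funB (measurable_condE mG (X2_integrable s)) (mg s)). Qed.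

Let rho_ge0 s x : 0 <= rho s x.
Proof. by rewrite subr_ge0 truncate_le_sqr. Qed.

Let r_ge0 s : {ae P, forall x, 0 <= r s x}.
Proof.
have : {ae P, forall x, g s x <= sigma2 s x}.
  by apply: (condE_le mG (Iphi s) (X2_integrable s)) => x; exact: truncate_le_sqr.
by apply: filterS => x; rewrite subr_ge0.
Qed.

Let eps := k `^ (- nu) * `|KX|.

(** After [truncation_error_le] the moment of order [2 + nu] is bounded on the sets of G, and the
    G-measurable multiplier [|h s|] can be inserted. *)
Let hrho s : (\int[P]_x (`|h s x| * rho s x)%:E <= eps%:E * \int[P]_x `|h s x|%:E)%E.
Proof.
have mah : measurable_fun [set: g_sigma_algebraType G] (fun x => `|h s x|) by exact: measurableT_comp.
have mahT : measurable_fun setT (fun x => `|h s x|) by exact: measurableT_comp.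
have mXp : measurable_fun setT (Xp s) by exact: (measurableT_comp measurable_powR_norm).
have k0 : 0 <= k `^ (- nu) by rewrite powR_ge0.
apply: (@le_trans _ _ (\int[P]_x (k `^ (- nu) * (`|h s x| * Xp s x))%:E)%E).
  apply: ge0_le_integral => //.
  - by move=> x _; rewrite lee_fin mulr_ge0.
  - by apply: measurableT_comp => //; exact: measurable_funM.
  - by apply: measurableT_comp => //; apply: measurable_funM => //; exact: measurable_funM.
  - move=> x _; rewrite lee_fin mulrCA ler_wpM2l//; exact: truncation_error_le.
under eq_integral do rewrite EFinM.
rewrite ge0_integralZl ?lee_fin//; last 2 first.
- by apply: measurableT_comp => //; exact: measurable_funM.
- by move=> x _; rewrite lee_fin mulr_ge0// powR_ge0.
rewrite /eps EFinM -muleA; apply: lee_wpmul2l; first by rewrite lee_fin.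
rewrite -ge0_integralZl//; last by apply: measurableT_comp.
under [leRHS]eq_integral do rewrite -EFinM mulrC.
apply: (le_integral_mul sG) => //.
- by move=> x; exact: powR_ge0.
- by move=> A GA; apply: integral_past_powR_le; exact: sub_past.
Qed.

Let hr s : (\int[P]_x (`|h s x| * `|r s x|)%:E = \int[P]_x (`|h s x| * rho s x)%:E)%E.
Proof.
have mrT : measurable_fun setT (r s) by exact: sub_measurable_fun (mr s).
have mah : measurable_fun [set: g_sigma_algebraType G] (fun x => `|h s x|) by exact: measurableT_comp.
have mahT : measurable_fun setT (fun x => `|h s x|) by exact: measurableT_comp.
have ahM x : `| `|h s x| | <= M by rewrite normr_id.
transitivity (\int[P]_x (`|h s x| * r s x)%:E)%E.
  apply: ae_eq_integral => //.
  - by apply: measurableT_comp => //; apply: measurable_funM => //; exact: measurableT_comp.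
  - by apply: measurableT_comp => //; exact: measurable_funM.
  - by apply: filterS (r_ge0 s) => x r0 _; rewrite (ger0_norm r0).
apply: (integral_mul_eq sG) => //.
- exact: (integrable_bounded_mul (Ir s) mahT ahM).
- exact: (integrable_bounded_mul (Irho s) mahT ahM).
- move=> A GA; have mA := sG GA; rewrite /r /rho.
  under eq_integral do rewrite EFinB.
  under [RHS]eq_integral do rewrite EFinB.
  have I1 := integrableS measurableT mA (@subsetT _ _) (Iphi s).
  have I2 := integrableS measurableT mA (@subsetT _ _) (X2_integrable s).
  have I3 := integrableS measurableT mA (@subsetT _ _) (integrable_condE mG (Iphi s)).
  have I4 := integrableS measurableT mA (@subsetT _ _) (Isigma s).
  rewrite integralB// [RHS]integralB//.
  by rewrite (integral_condE mG (X2_integrable s) GA) (integral_condE mG (Iphi s) GA).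
Qed.

Let mE s : measurable_fun setT (tail_innovation s).
Proof.
have mrT : measurable_fun setT (r s) by exact: sub_measurable_fun (mr s).
exact: (measurable_funB (mrho s) mrT).
Qed.

Lemma measurable_tail : measurable_fun setT (fun x => \sum_s h s x * tail_innovation s x).
Proof. by apply: measurable_sum => s; exact: measurable_funM. Qed.

(** No cancellation between sectors is used: [rho s] and its conditional mean [r s] contribute the
    same amount, whence the factor 2. *)
Lemma integral_tail_le :
  (\int[P]_x `|\sum_s h s x * tail_innovation s x|%:E <=
   (2 * k `^ (- nu) * `|KX|)%:E * \sum_s \int[P]_x `|h s x|%:E)%E.
Proof.
have mrT s : measurable_fun setT (r s) by exact: sub_measurable_fun (mr s).
have mahT s : measurable_fun setT (fun x => `|h s x|) by exact: measurableT_comp.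
have m1 s : measurable_fun setT (fun x => (`|h s x| * rho s x)%:E).
  by apply: measurableT_comp => //; exact: measurable_funM.
have m2 s : measurable_fun setT (fun x => (`|h s x| * `|r s x|)%:E).
  by apply: measurableT_comp => //; apply: measurable_funM => //; exact: measurableT_comp.
apply: (@le_trans _ _ (\int[P]_x \sum_s ((`|h s x| * rho s x)%:E + (`|h s x| * `|r s x|)%:E))%E).
  apply: ge0_le_integral => //.
  - by apply: measurableT_comp => //; apply: measurableT_comp => //; exact: measurable_tail.
  - by apply: emeasurable_sum => s; exact: emeasurable_funD.
  - move=> x _; rewrite sumEFin lee_fin.
    apply: le_trans (ler_norm_sum _ _ _) _; apply: ler_sum => s _.
    rewrite normrM -mulrDr ler_wpM2l// (le_trans (ler_normB _ _))//.
    by apply: lerD => //; rewrite -/(rho s x) (ger0_norm (rho_ge0 s x)).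
rewrite ge0_integral_sum//; last 2 first.
- by move=> s; exact: emeasurable_funD.
- by move=> s x _; rewrite adde_ge0// lee_fin mulr_ge0.
rewrite ge0_sume_distrr; last by move=> s _; apply: integral_ge0 => x _; rewrite lee_fin.
apply: lee_sum => s _; rewrite ge0_integralD//; last by move=> x _; rewrite lee_fin mulr_ge0.
rewrite hr (_ : 2 * _ * _ = eps + eps); last by rewrite /eps; ring.
rewrite EFinD ge0_muleDl; [|by rewrite lee_fin mulr_ge0// powR_ge0..].
by apply: leeD; exact: hrho.
Qed.

Lemma truncation_split x : \sum_s h s x * (X s x ^+ 2 - sigma2 s x) =
  \sum_s h s x * truncated_innovation s x + \sum_s h s x * tail_innovation s x.
Proof.
rewrite -big_split/=; apply: eq_bigr => s _.
by rewrite /truncated_innovation /tail_innovation; ring.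
Qed.

End diagonal.

(** With [y] as Y_i(0) and [h] as the products w_it b_it, this splits X_i Y_i into the linear,
    off-diagonal and diagonal forms. *)
Lemma shifter_product (v h : 'I_n -> R) (y : R) (u : 'I_n -> R) :
  (\sum_s v s * u s) * (y + \sum_t h t * u t) =
  \sum_s (v s * y) * u s + \sum_s \sum_(t | t != s) (v s * h t) * u s * u t +
  \sum_s (v s * h s) * u s ^+ 2.
Proof.
rewrite mulr_suml -!big_split/=; apply: eq_bigr => s _.
rewrite mulrDr mulr_sumr (bigD1 s)//= [X in _ + (_ + X) = _](eq_bigr (fun t => v s * h t * u s * u t)).
  by ring.
by move=> t _; ring.
Qed.

(** The linear and off-diagonal forms integrate to zero over every set of G, so only the diagonal
    survives; this is the source of the weighted average formula for the estimand. *)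
Lemma condE_shifter_product (v h : 'I_n -> T -> R) (y : T -> R) (M : R) :
  (forall s, measurable_fun [set: g_sigma_algebraType G] (v s)) ->
  (forall s, measurable_fun [set: g_sigma_algebraType G] (h s)) ->
  measurable_fun [set: g_sigma_algebraType G] y ->
  (forall s x, `|v s x| <= M) -> (forall s x, `|h s x| <= M) -> sqi P y ->
  P.-integrable setT (EFin \o (fun x => (\sum_s v s x * X s x) * (y x + \sum_t h t x * X t x))) /\
  {ae P, forall x,
    condE P G (fun x => (\sum_s v s x * X s x) * (y x + \sum_t h t x * X t x)) x =
    \sum_s v s x * h s x * sigma2 s x}.
Proof.
move=> mv mh my vM hM sy.
have mvT s : measurable_fun setT (v s) by exact: sub_measurable_fun (mv s).
have mhT s : measurable_fun setT (h s) by exact: sub_measurable_fun (mh s).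
have svX : sqi P (fun x => \sum_s v s x * X s x).
  by apply: sqi_sum => s _; exact: (sqi_bounded_mul (mvT s) (vM s) (sqi_X s)).
have shX : sqi P (fun x => \sum_s h s x * X s x).
  by apply: sqi_sum => s _; exact: (sqi_bounded_mul (mhT s) (hM s) (sqi_X s)).
have IQ := sqi_mul svX (sqiD sy shX).
split=> //.
have mvh s t : measurable_fun [set: g_sigma_algebraType G] (fun x => v s x * h t x).
  exact: measurable_funM.
have mvhT s t : measurable_fun setT (fun x => v s x * h t x) by exact: sub_measurable_fun (mvh s t).
have vhM s t x : `|v s x * h t x| <= M ^+ 2 by rewrite normrM expr2 ler_pM.
have Is s := integrable_condE mG (X2_integrable s).
have Ivhs s : P.-integrable setT (EFin \o (fun x => v s x * h s x * sigma2 s x)).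
  exact: (integrable_bounded_mul (Is s) (mvhT s s) (vhM s s)).
have IvhX s : P.-integrable setT (EFin \o (fun x => v s x * h s x * X s x ^+ 2)).
  exact: (integrable_bounded_mul (X2_integrable s) (mvhT s s) (vhM s s)).
have Ivhs_sum : P.-integrable setT (EFin \o (fun x => \sum_s v s x * h s x * sigma2 s x)).
  rewrite (_ : _ \o _ = fun x => (\sum_s (v s x * h s x * sigma2 s x)%:E)%E).
    by apply: integrable_sum => // s _; exact: Ivhs.
  by apply/funext => x /=; rewrite sumEFin.
have IvhX_sum : P.-integrable setT (EFin \o (fun x => \sum_s v s x * h s x * X s x ^+ 2)).
  rewrite (_ : _ \o _ = fun x => (\sum_s (v s x * h s x * X s x ^+ 2)%:E)%E).
    by apply: integrable_sum => // s _; exact: IvhX.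
  by apply/funext => x /=; rewrite sumEFin.
(* The candidate is verified through its integrals over sets of G, and uniqueness of versions
   concludes. *)
apply: (condE_unique mG IQ); split=> //.
  apply: measurable_sum => s; apply: measurable_funM => //.
  exact: measurable_condE (X2_integrable s).
move=> A GA; have mA := sG GA.
have svy s : sqi P (fun x => v s x * y x) by exact: (sqi_bounded_mul (mvT s) (vM s) sy).
have svyX : sqi P (fun x => \sum_s v s x * y x * X s x).
  by apply: (sqi_linear _ svy).1 => s; exact: measurable_funM.
have sB := sqi_offdiag mvh vhM.
have sub f : P.-integrable setT f -> P.-integrable A f.
  exact: (integrableS measurableT mA (@subsetT _ _)).
under [RHS]eq_integral do rewrite shifter_product !EFinD.
rewrite integralD//; last 2 first.
- exact: (sub _ (integrableD measurableT (sqi_integrable svyX) (sqi_integrable sB))).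
- exact: (sub _ IvhX_sum).
rewrite integralD//; last 2 first.
- exact: (sub _ (sqi_integrable svyX)).
- exact: (sub _ (sqi_integrable sB)).
have -> := offdiag_mean0 mvh vhM GA.
have -> : (\int[P]_(x in A) (\sum_s v s x * y x * X s x)%:E = 0)%E.
  by apply: predictable_mean0 => // s; apply: measurable_past_G; exact: measurable_funM.
rewrite !add0e.
under [LHS]eq_integral do rewrite -sumEFin.
under [RHS]eq_integral do rewrite -sumEFin.
rewrite integral_sum//; last by move=> s; exact: (sub _ (Ivhs s)).
rewrite [RHS]integral_sum//; last by move=> s; exact: (sub _ (IvhX s)).
apply: eq_bigr => s _; rewrite integral_mkcond [RHS]integral_mkcond.
have e f : (\int[P]_x ((fun x => (v s x * h s x * f x)%:E) \_ A) x =
    \int[P]_x (\1_A x * (v s x * h s x) * f x)%:E)%E.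
  by apply: eq_integral => x _; rewrite epatch_indic/= -EFinM; congr _%:E; ring.
rewrite !e.
have mA1 : measurable_fun [set: g_sigma_algebraType G] (\1_A : T -> R).
  exact: (@measurable_indic _ (g_sigma_algebraType G)).
have mH : measurable_fun [set: g_sigma_algebraType G] (fun x => \1_A x * (v s x * h s x)).
  exact: measurable_funM.
have mHT : measurable_fun setT (fun x => \1_A x * (v s x * h s x)) by exact: sub_measurable_fun mH.
have HM x : `|\1_A x * (v s x * h s x)| <= M ^+ 2.
  by rewrite normrM -[leRHS]mul1r ler_pM// indicE ger0_norm// lern1 leq_b1.
apply: (integral_mul_eq sG) => //.
- exact: Is.
- exact: X2_integrable.
- exact: (integrable_bounded_mul (Is s) mHT HM).
- exact: (integrable_bounded_mul (X2_integrable s) mHT HM).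
- by move=> A' GA'; rewrite (integral_condE mG (X2_integrable s) GA').
Qed.

End shifters.

(** * Share weights *)

(** For [m = 0] the left-hand side is 0, the inverse of 0 being 0, so rows without regions are no
    exception. *)
Lemma mean_le1 (R : realType) (m : nat) (a : R) : a <= m%:R -> m%:R^-1 * a <= 1.
Proof.
have [->|m0] := posnP m; first by rewrite invr0 mul0r.
by rewrite mulrC ler_pdivrMr ?ltr0n// mul1r.
Qed.

Section weights.
Context (R : realType) (N n : nat).
Variables (w : 'I_N -> 'I_n -> R).

Definition cross_coef (b : 'I_N -> 'I_n -> R) s t := N%:R^-1 * \sum_i w i s * (w i t * b i t).

Definition linear_coef (y : 'I_N -> R) s := N%:R^-1 * \sum_i w i s * y i.

Definition concentration := N%:R^-1 ^+ 2 * \sum_s (\sum_i w i s) ^+ 2.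

Lemma shift_share_split (b : 'I_N -> 'I_n -> R) (y : 'I_N -> R) (u v : 'I_n -> R) :
  N%:R^-1 * \sum_i (\sum_s w i s * u s) * (y i + \sum_t (w i t * b i t) * u t) -
  N%:R^-1 * \sum_i \sum_s w i s * (w i s * b i s) * v s =
  \sum_s linear_coef y s * u s +
  \sum_s \sum_(t | t != s) cross_coef b s t * u s * u t +
  \sum_s cross_coef b s s * (u s ^+ 2 - v s).
Proof.
under eq_bigr do rewrite shifter_product.
rewrite !big_split/= !mulrDr -addrA; congr (_ + _).
  congr (_ + _).
    rewrite exchange_big/= mulr_sumr; apply: eq_bigr => s _.
    by rewrite /linear_coef -mulrA mulr_suml.
  rewrite exchange_big/= mulr_sumr; apply: eq_bigr => s _.
  rewrite exchange_big/= mulr_sumr; apply: eq_bigr => t _.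
  rewrite /cross_coef -!mulrA mulr_suml; congr (_ * _).
  by apply: eq_bigr => i _; ring.
rewrite -mulrBr -sumrB; under [X in _ * X = _]eq_bigr do rewrite -sumrB.
rewrite exchange_big/= mulr_sumr; apply: eq_bigr => s _.
rewrite /cross_coef -!mulrA mulr_suml; congr (_ * _).
by apply: eq_bigr => i _; ring.
Qed.

Lemma sum_sqr_le (I : finType) (a : I -> R) : (forall i, 0 <= a i) ->
  \sum_i a i ^+ 2 <= (\sum_i a i) ^+ 2.
Proof.
move=> a0; rewrite [leRHS]expr2 mulr_suml; apply: ler_sum => i _.
rewrite expr2 ler_wpM2l// (bigD1 i)//= lerDl sumr_ge0//.
Qed.

(** Cauchy-Schwarz by Lagrange's identity: the difference of the two sides is half the double sum of
    a_i a_j (y_i - y_j)^2. *)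
Lemma weighted_sum_sqr_le (I : finType) (a y : I -> R) : (forall i, 0 <= a i) ->
  (\sum_i a i * y i) ^+ 2 <= (\sum_i a i) * \sum_i a i * y i ^+ 2.
Proof.
move=> a0.
have : 0 <= \sum_i \sum_j a i * a j * (y i - y j) ^+ 2.
  by do 2 (apply: sumr_ge0 => ? _); rewrite mulr_ge0 ?sqr_ge0// mulr_ge0.
have -> : \sum_i \sum_j a i * a j * (y i - y j) ^+ 2 =
    2 * ((\sum_i a i) * \sum_i a i * y i ^+ 2) - 2 * (\sum_i a i * y i) ^+ 2.
  have e1 : (\sum_i a i) * (\sum_i a i * y i ^+ 2) = \sum_i \sum_j a i * a j * y j ^+ 2.
    rewrite mulr_suml; apply: eq_bigr => i _; rewrite mulr_sumr.
    by apply: eq_bigr => j _; ring.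
  have e2 : (\sum_i a i) * (\sum_i a i * y i ^+ 2) = \sum_i \sum_j a i * a j * y i ^+ 2.
    rewrite mulrC mulr_suml; apply: eq_bigr => i _; rewrite mulr_sumr.
    by apply: eq_bigr => j _; ring.
  have e3 : (\sum_i a i * y i) ^+ 2 = \sum_i \sum_j a i * a j * (y i * y j).
    rewrite expr2 mulr_suml; apply: eq_bigr => i _; rewrite mulr_sumr.
    by apply: eq_bigr => j _; ring.
  rewrite mulr_natl mulr2n {1}e1 e2 e3 mulr_sumr -big_split/= -sumrB; apply: eq_bigr => i _.
  rewrite mulr_sumr -big_split/= -sumrB; apply: eq_bigr => j _.
  by ring.
by lra.
Qed.

Hypothesis w_ge0 : forall i s, 0 <= w i s.
Hypothesis w_le1 : forall i, \sum_s w i s <= 1.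

Lemma weight_le1 i s : w i s <= 1.
Proof. by apply: le_trans (w_le1 i); rewrite (bigD1 s)//= lerDl sumr_ge0. Qed.

Lemma concentration_ge0 : 0 <= concentration.
Proof. by rewrite mulr_ge0 ?sqr_ge0// sumr_ge0// => s _; rewrite sqr_ge0. Qed.

Let V0 : 0 <= N%:R^-1 :> R. Proof. by rewrite invr_ge0. Qed.

Lemma total_size_le : \sum_s \sum_i w i s <= N%:R.
Proof.
rewrite exchange_big/=.
have -> : N%:R = \sum_(i < N) (1 : R) by rewrite sumr_const card_ord.
by apply: ler_sum => i _.
Qed.

(** The sum of n_s^2 is at most max n_s times the total size, and the total size is at most N since
    row sums are at most 1; hence the bound by the share times (total / N)^2. *)
Lemma concentration_le_share :
  concentration <= (\big[Num.max/0]_(s < n) \sum_i w i s) / \sum_(t < n) \sum_i w i t.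
Proof.
set m := \big[_/_]_(s < n) _; set tot := \sum_(t < n) _.
have n0 s : 0 <= \sum_i w i s by apply: sumr_ge0.
have tot0 : 0 <= tot by exact: sumr_ge0.
have m0 : 0 <= m by exact: bigmax_ge_id.
have le1 : \sum_s (\sum_i w i s) ^+ 2 <= m * tot.
  rewrite mulr_sumr; apply: ler_sum => s _; rewrite expr2 ler_wpM2r//.
  exact: (le_bigmax 0 (fun s => \sum_i w i s)).
(* Division by 0 makes the share 0, and [le1] then leaves no room for a positive sum of squares. *)
have [t0|tn0] := eqVneq tot 0.
  rewrite t0 invr0 mulr0 /concentration mulr_ge0_le0 ?sqr_ge0//.
  by move: le1; rewrite t0 mulr0.
have tp : 0 < tot by rewrite lt_neqAle eq_sym tn0.
have Np : 0 < N%:R :> R by exact: lt_le_trans tp total_size_le.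
rewrite /concentration; apply: (@le_trans _ _ (N%:R^-1 ^+ 2 * (m * tot))).
  by rewrite ler_wpM2l// sqr_ge0.
have -> : N%:R^-1 ^+ 2 * (m * tot) = m / tot * (tot / N%:R) ^+ 2.
  by field; rewrite gt_eqF// tn0.
rewrite ler_piMr ?divr_ge0// expr_le1 ?divr_ge0//.
by rewrite ler_pdivrMr// mul1r total_size_le.
Qed.

(** Supplies the dominating constant when almost sure convergence of the concentration is turned
    into convergence of its expectation. *)
Lemma concentration_le1 : concentration <= 1.
Proof.
have n0 s : 0 <= \sum_i w i s by apply: sumr_ge0.
apply: (@le_trans _ _ (N%:R^-1 ^+ 2 * (\sum_s \sum_i w i s) ^+ 2)).
  by rewrite ler_wpM2l ?sqr_ge0// sum_sqr_le.
rewrite -exprMn expr_le1// ?mulr_ge0 ?sumr_ge0//.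
exact: mean_le1 total_size_le.
Qed.

Variables (b : 'I_N -> 'I_n -> R) (K : R).
Hypothesis bK : forall i s, `|b i s| <= K.

Lemma cross_coef_le s t : `|cross_coef b s t| <= K * (N%:R^-1 * \sum_i w i s * w i t).
Proof.
rewrite normrM ger0_norm// mulrCA ler_wpM2l// mulr_sumr.
apply: le_trans (ler_norm_sum _ _ _) _; apply: ler_sum => i _.
by rewrite !normrM !(ger0_norm (w_ge0 _ _)) [leRHS]mulrC -mulrA !ler_wpM2l.
Qed.

(** For fixed s the squares of the nonnegative [A s t] sum to at most the square of their sum over
    t, and that sum is at most n_s / N because the row sums of the weights are at most 1. *)
Lemma cross_coef_sum_sqr : \sum_s \sum_t cross_coef b s t ^+ 2 <= K ^+ 2 * concentration.
Proof.
pose A s t := N%:R^-1 * \sum_i w i s * w i t.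
have A0 s t : 0 <= A s t by rewrite mulr_ge0// sumr_ge0// => i _; rewrite mulr_ge0.
rewrite /concentration !mulr_sumr; apply: ler_sum => s _.
apply: (@le_trans _ _ (\sum_t K ^+ 2 * A s t ^+ 2)).
  apply: ler_sum => t _; rewrite -exprMn -(real_normK (num_real (cross_coef b s t))).
  rewrite lerXn2r// ?nnegrE//; last exact: cross_coef_le.
  by rewrite (le_trans _ (cross_coef_le s t)).
rewrite -mulr_sumr ler_wpM2l ?sqr_ge0// -exprMn.
apply: le_trans (sum_sqr_le (A0 s)) _.
rewrite lerXn2r// ?nnegrE ?sumr_ge0// ?mulr_ge0 ?sumr_ge0// -mulr_sumr ler_wpM2l//.
rewrite exchange_big/=; apply: ler_sum => i _.
by rewrite -mulr_sumr ler_piMr.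
Qed.

Lemma cross_coef_diag_sqr : \sum_s cross_coef b s s ^+ 2 <= K ^+ 2 * concentration.
Proof.
apply: le_trans cross_coef_sum_sqr; apply: ler_sum => s _.
by rewrite (bigD1 s)//= lerDl sumr_ge0// => t _; rewrite sqr_ge0.
Qed.

(** In contrast to the sums of squares this bound does not tend to zero, so the tail of the diagonal
    form becomes small only through the truncation level. *)
Lemma cross_coef_diag_norm : 0 <= K -> \sum_s `|cross_coef b s s| <= K.
Proof.
move=> K0; apply: (@le_trans _ _ (\sum_s K * (N%:R^-1 * \sum_i w i s * w i s))).
  by apply: ler_sum => s _; exact: cross_coef_le.
rewrite -!mulr_sumr ler_piMr//.
apply: mean_le1; apply: le_trans total_size_le.
apply: ler_sum => s _; apply: ler_sum => i _; rewrite ler_piMr//; exact: weight_le1.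
Qed.

Lemma cross_coef_bounded s t : 0 <= K -> `|cross_coef b s t| <= K.
Proof.
move=> K0; apply: le_trans (cross_coef_le s t) _; rewrite ler_piMr//.
apply: mean_le1.
have -> : N%:R = \sum_(i < N) (1 : R) by rewrite sumr_const card_ord.
by apply: ler_sum => i _; rewrite mulr_ile1// weight_le1.
Qed.

(** Cauchy-Schwarz with weights w_is for each sector. The coefficients of y_i^2 depend on the
    weights alone, and by [concentrationE] they add up to the concentration. *)
Lemma linear_coef_sqr (y : 'I_N -> R) :
  \sum_s linear_coef y s ^+ 2 <= \sum_i (\sum_s N%:R^-1 ^+ 2 * (\sum_j w j s) * w i s) * y i ^+ 2.
Proof.
under [leRHS]eq_bigr do rewrite mulr_suml.
rewrite [leRHS]exchange_big/=; apply: ler_sum => s _.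
rewrite /linear_coef exprMn.
have -> : \sum_i N%:R^-1 ^+ 2 * (\sum_j w j s) * w i s * y i ^+ 2 =
    N%:R^-1 ^+ 2 * ((\sum_j w j s) * \sum_i w i s * y i ^+ 2).
  by rewrite !mulr_sumr; apply: eq_bigr => i _; rewrite -mulr_sumr !mulrA.
by rewrite ler_wpM2l ?sqr_ge0// weighted_sum_sqr_le.
Qed.

Lemma concentrationE : \sum_i (\sum_s N%:R^-1 ^+ 2 * (\sum_j w j s) * w i s) = concentration.
Proof.
rewrite exchange_big/= /concentration mulr_sumr; apply: eq_bigr => s _.
by rewrite -mulr_sumr -mulrA -expr2.
Qed.

End weights.

(** * Moment bounds for one row of the array *)

Section row_bounds.
Context d (T : measurableType d) (R : realType) (P : probability T R).
Variables (G gW : set (set T)).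
Hypothesis mG : forall A, G A -> measurable A.
Hypothesis gWG : forall A, <<s gW >> A -> <<s G >> A.
Variables (N n : nat) (X : 'I_n -> {RV P >-> R}).
Hypothesis X_indep : cond_independent G X.
Hypothesis X_mean0 : forall s, {ae P, forall x, condE P G (X s) x = 0}.
Variables (nu KX KY K : R).
Hypothesis nu_gt0 : 0 < nu.
Hypothesis X_int : forall s, P.-integrable setT (EFin \o (fun x => `|X s x| `^ (2 + nu))).
Hypothesis X_bound : forall s, {ae P, forall x, condE P G (fun y => `|X s y| `^ (2 + nu)) x <= KX}.
Variables (w b : 'I_N -> 'I_n -> T -> R) (Y0 : 'I_N -> T -> R).
Hypothesis mw : forall i s, measurable_fun [set: g_sigma_algebraType gW] (w i s).
Hypothesis w_ge0 : forall i s x, 0 <= w i s x.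
Hypothesis w_le1 : forall i x, \sum_s w i s x <= 1.
Hypothesis mb : forall i s, measurable_fun [set: g_sigma_algebraType G] (b i s).
Hypothesis K_ge0 : 0 <= K.
Hypothesis bK : forall i s x, `|b i s x| <= K.
Hypothesis mY0 : forall i, measurable_fun [set: g_sigma_algebraType G] (Y0 i).
Hypothesis Y0_sqi : forall i, sqi P (Y0 i).
Hypothesis Y0_bound : forall i, {ae P, forall x, condE P gW (fun y => Y0 i y ^+ 2) x <= KY}.

Let sG := sub_sigma_measurable mG.
Let C := 1 + `|KX|.
Let C_ge0 : 0 <= C. Proof. by rewrite addr_ge0. Qed.
Let N_ge0 : 0 <= N%:R^-1 :> R. Proof. by rewrite invr_ge0. Qed.

Let mgW A : gW A -> measurable A.
Proof. by move=> gA; apply: sG; apply: gWG; exact: sub_sigma_algebra. Qed.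

Let mwG i s : measurable_fun [set: g_sigma_algebraType G] (w i s).
Proof. by move=> _ B mB; apply: gWG; exact: (mw i s measurableT mB). Qed.

Let w_norm i s x : `|w i s x| <= 1.
Proof. by rewrite ger0_norm// (weight_le1 (w := fun i s => w i s x)). Qed.

Let cross s t x := cross_coef (fun i s => w i s x) (fun i s => b i s x) s t.
Let lin s x := linear_coef (fun i s => w i s x) (Y0 ^~ x) s.
Let V x := concentration (fun i s => w i s x).

Lemma measurable_concentration : measurable_fun setT V.
Proof.
apply: measurable_funM => //; apply: measurable_sum => s; apply: measurable_funX.
by apply: measurable_sum => i; exact: sub_measurable_fun (mwG i s).
Qed.

Let V_ge0 x : 0 <= V x. Proof. exact: concentration_ge0. Qed.

Let mcross s t : measurable_fun [set: g_sigma_algebraType G] (cross s t).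
Proof.
apply: measurable_funM => //; apply: measurable_sum => i.
by apply: measurable_funM => //; exact: measurable_funM.
Qed.

Let crossK s t x : `|cross s t x| <= K.
Proof. exact: cross_coef_bounded. Qed.

Let mlin s : measurable_fun [set: g_sigma_algebraType G] (lin s).
Proof.
by apply: measurable_funM => //; apply: measurable_sum => i; exact: measurable_funM.
Qed.

Let integral_cV (c : R) : 0 <= c -> (\int[P]_x (c * V x)%:E = c%:E * \int[P]_x (V x)%:E)%E.
Proof.
move=> c0; under eq_integral do rewrite EFinM.
rewrite ge0_integralZl//; last by move=> x _; rewrite lee_fin.
by apply: measurableT_comp => //; exact: measurable_concentration.
Qed.

Let m_sqr (f : T -> R) : measurable_fun setT f -> measurable_fun setT (fun x => (f x ^+ 2)%:E).
Proof. by move=> mf; apply: measurableT_comp => //; exact: measurable_funX. Qed.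

Lemma integral_cross_off_diagonal :
  sqi P (fun x => \sum_s \sum_(t | t != s) cross s t x * X s x * X t x) /\
  (\int[P]_x ((\sum_s \sum_(t | t != s) cross s t x * X s x * X t x) ^+ 2)%:E <=
   (4 * C ^+ 2 * K ^+ 2)%:E * \int[P]_x (V x)%:E)%E.
Proof.
have mcT s t : measurable_fun setT (cross s t) by exact: sub_measurable_fun (mcross s t).
split; first exact: (sqi_offdiag mG X_indep X_mean0 nu_gt0 X_int X_bound mcross crossK).
apply: le_trans (integral_offdiag_sqr mG X_indep X_mean0 nu_gt0 X_int X_bound mcross crossK) _.
rewrite [leRHS](_ : _ = (4 * C ^+ 2)%:E * ((K ^+ 2)%:E * \int[P]_x (V x)%:E))%E; last first.
  by rewrite EFinM -muleA.
apply: lee_wpmul2l; first by rewrite lee_fin mulr_ge0 ?sqr_ge0.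
rewrite -(integral_cV (sqr_ge0 _)).
rewrite (eq_bigr (fun s => \int[P]_x (\sum_t (cross s t x ^+ 2)%:E))%E) => [|s _]; last first.
  rewrite ge0_integral_sum//; first by move=> t; exact: m_sqr.
  by move=> t x _; rewrite lee_fin sqr_ge0.
rewrite -ge0_integral_sum//; last 2 first.
- by move=> s; apply: emeasurable_sum => t; exact: m_sqr.
- by move=> s x _; apply: sume_ge0 => t _; rewrite lee_fin sqr_ge0.
apply: ge0_le_integral => //.
- by move=> x _; do 2 (apply: sume_ge0 => ? _); rewrite lee_fin sqr_ge0.
- by do 2 (apply: emeasurable_sum => ?); exact: m_sqr.
- by apply: measurableT_comp => //; apply: measurable_funM => //; exact: measurable_concentration.
- move=> x _; under eq_bigr do rewrite sumEFin; rewrite sumEFin lee_fin.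
  exact: cross_coef_sum_sqr.
Qed.

Lemma integral_cross_truncated (k : R) : 0 < k ->
  sqi P (fun x => \sum_s cross s s x * truncated_innovation G X k s x) /\
  (\int[P]_x ((\sum_s cross s s x * truncated_innovation G X k s x) ^+ 2)%:E <=
   (k ^+ 4 * K ^+ 2)%:E * \int[P]_x (V x)%:E)%E.
Proof.
move=> k0.
have mcT s t : measurable_fun setT (cross s t) by exact: sub_measurable_fun (mcross s t).
have [sT /le_trans le] := sqi_truncated mG X_indep (fun s => mcross s s) (fun s => crossK s s) k0.
split=> //; apply: le.
rewrite [(k ^+ 4 * K ^+ 2)%:E]EFinM -muleA; apply: lee_wpmul2l; first by rewrite lee_fin exprn_ge0// ltW.
rewrite -(integral_cV (sqr_ge0 _)).
rewrite -ge0_integral_sum//; last 2 first.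
- by move=> s; exact: m_sqr.
- by move=> s x _; rewrite lee_fin sqr_ge0.
apply: ge0_le_integral => //.
- by move=> x _; apply: sume_ge0 => ? _; rewrite lee_fin sqr_ge0.
- by apply: emeasurable_sum => ?; exact: m_sqr.
- by apply: measurableT_comp => //; apply: measurable_funM => //; exact: measurable_concentration.
- by move=> x _; rewrite sumEFin lee_fin; exact: cross_coef_diag_sqr.
Qed.

Lemma integral_cross_tail (k : R) : 0 < k ->
  measurable_fun setT (fun x => \sum_s cross s s x * tail_innovation G X k s x) /\
  (\int[P]_x `|\sum_s cross s s x * tail_innovation G X k s x|%:E <=
   (2 * k `^ (- nu) * `|KX| * K)%:E)%E.
Proof.
move=> k0.
have mcT s t : measurable_fun setT (cross s t) by exact: sub_measurable_fun (mcross s t).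
split.
  exact: (measurable_tail mG nu_gt0 X_int k (fun s => mcross s s)).
have le := integral_tail_le mG X_indep nu_gt0 X_int X_bound (fun s => mcross s s) (fun s => crossK s s) k0.
apply: le_trans le _; rewrite [leRHS]EFinM; apply: lee_wpmul2l.
  by rewrite lee_fin !mulr_ge0// powR_ge0.
rewrite -ge0_integral_sum//; last first.
  by move=> s; do 2 (apply: measurableT_comp => //).
apply: (@le_trans _ _ (\int[P]_x (cst K%:E x))%E); last first.
  have -> : (\int[P]_x (cst K%:E x) = K%:E * P setT)%E by exact: integral_cst.
  by rewrite probability_setT mule1.
apply: ge0_le_integral => //.
- by move=> x _; apply: sume_ge0 => ? _; rewrite lee_fin.
- by apply: emeasurable_sum => s; do 2 (apply: measurableT_comp => //).
- by move=> x _; rewrite sumEFin lee_fin; exact: cross_coef_diag_norm.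
Qed.

Lemma integral_linear :
  sqi P (fun x => \sum_s lin s x * X s x) /\
  (\int[P]_x ((\sum_s lin s x * X s x) ^+ 2)%:E <=
   (C * `|KY|)%:E * \int[P]_x (V x)%:E)%E.
Proof.
have sl s : sqi P (lin s).
  apply: (sqi_bounded_mul (M := N%:R^-1)) => //; first by move=> x; rewrite ger0_norm.
  apply: sqi_sum => i _; apply: (sqi_bounded_mul (M := 1)) => //.
  exact: sub_measurable_fun (mwG i s).
have mlT s : measurable_fun setT (lin s) by have [] := sl s.
have [sL /le_trans le] := sqi_linear mG X_indep X_mean0 nu_gt0 X_int X_bound mlin sl.
split=> //; apply: le.
rewrite [(C * `|KY|)%:E]EFinM -muleA; apply: lee_wpmul2l; first by rewrite lee_fin.
rewrite -ge0_integral_sum//; last 2 first.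
- by move=> s; exact: m_sqr.
- by move=> s x _; rewrite lee_fin sqr_ge0.
(* The coefficients of [linear_coef_sqr]. They are measurable for [gW], so the bound on the second
   moment of [Y0 i] given [gW], rather than [G], can be integrated against them. *)
pose c i x := \sum_s N%:R^-1 ^+ 2 * (\sum_j w j s x) * w i s x.
have c0 i x : 0 <= c i x.
  apply: sumr_ge0 => s _; apply: mulr_ge0 => //; apply: mulr_ge0; first exact: sqr_ge0.
  exact: sumr_ge0.
have mc i : measurable_fun [set: g_sigma_algebraType gW] (c i).
  apply: measurable_sum => s; apply: measurable_funM => //; apply: measurable_funM => //.
  exact: measurable_sum.
have mcT i : measurable_fun setT (c i).
  exact: (sub_measurable_fun (sub_sigma_measurable mgW) (mc i)).
have mYT i : measurable_fun setT (Y0 i) by have [] := Y0_sqi i.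
apply: (@le_trans _ _ (\int[P]_x (\sum_i (c i x * Y0 i x ^+ 2)%:E))%E).
  apply: ge0_le_integral => //.
  - by move=> x _; apply: sume_ge0 => ? _; rewrite lee_fin sqr_ge0.
  - by apply: emeasurable_sum => ?; exact: m_sqr.
  - apply: emeasurable_sum => i; apply: measurableT_comp => //; apply: measurable_funM => //.
    exact: measurable_funX.
  - by move=> x _; rewrite !sumEFin lee_fin; exact: linear_coef_sqr.
rewrite ge0_integral_sum//; last 2 first.
- move=> i; apply: measurableT_comp => //; apply: measurable_funM => //.
  exact: measurable_funX.
- by move=> i x _; rewrite lee_fin mulr_ge0// sqr_ge0.
apply: (@le_trans _ _ (\sum_i \int[P]_x (c i x * `|KY|)%:E)%E).
  apply: lee_sum => i _; apply: (le_integral_mul (sub_sigma_measurable mgW)) => //.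
  - exact: measurable_funX.
  - by move=> x; exact: sqr_ge0.
  - move=> A gA; have mA := sub_sigma_measurable mgW gA.
    have I2 : P.-integrable setT (EFin \o (fun x => Y0 i x ^+ 2)) by have [] := Y0_sqi i.
    rewrite -(integral_condE mgW I2 gA); apply: ae_le_integral => //.
    + exact: integrable_condE.
    + exact: finite_measure_integrable_cst.
    + by apply: filterS (Y0_bound i) => x /le_trans; apply; exact: ler_norm.
rewrite -(integral_cV (normr_ge0 _)) -ge0_integral_sum//; last 2 first.
- by move=> i; apply: measurableT_comp => //; exact: measurable_funM.
- by move=> i x _; rewrite lee_fin mulr_ge0.
rewrite le_eqVlt; apply/orP; left; apply/eqP; apply: eq_integral => x _.
by rewrite sumEFin -mulr_suml mulrC /V -concentrationE.
Qed.

End row_bounds.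

(** * Convergence in probability *)

Section limits_in_probability.
Context (R : realType).

Lemma cvge0_le (u : nat -> \bar R) : (forall S, 0 <= u S)%E ->
  (forall e : R, 0 < e -> \forall S \near \oo, (u S <= e%:E)%E) ->
  u S @[S --> \oo] --> 0%E.
Proof.
move=> u0 ue; apply/fine_cvgP; split.
  have := ue 1 ltr01; apply: filterS => S uS.
  by rewrite ge0_fin_numE// (le_lt_trans uS)// ltry.
apply/cvgrPdist_le => e e0; have := ue e e0; apply: filterS => S uS.
rewrite sub0r normrN /= ger0_norm ?fine_ge0//.
by rewrite -lee_fin fineK// ge0_fin_numE// (le_lt_trans uS)// ltry.
Qed.

Lemma near_le_cvge0 (u : nat -> \bar R) : (forall S, 0 <= u S)%E ->
  u S @[S --> \oo] --> 0%E ->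
  forall e : R, 0 < e -> \forall S \near \oo, (u S <= e%:E)%E.
Proof.
move=> u0 /fine_cvgP[ufin /cvgrPdist_le u_0] e e0.
have := u_0 e e0; apply: filterS2 ufin => S fu.
rewrite sub0r normrN /= ger0_norm ?fine_ge0// -lee_fin fineK//.
Qed.

Lemma squeeze_cvge0 (u v : nat -> \bar R) : (forall S, 0 <= u S)%E ->
  (forall S, u S <= v S)%E -> v S @[S --> \oo] --> 0%E -> u S @[S --> \oo] --> 0%E.
Proof.
move=> u0 uv v0; apply: (squeeze_cvge (f := cst 0%E) _ (cvg_cst 0%E) v0).
by apply: nearW => S; rewrite u0 uv.
Qed.

Section probability_bounds.
Context d (T : measurableType d) (P : probability T R).

Lemma markov_ge0 (f : T -> R) (e : R) : measurable_fun setT f -> (forall x, 0 <= f x) ->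
  (e%:E * P [set x | (e <= f x)%R] <= \int[P]_x (f x)%:E)%E.
Proof.
move=> mf f0.
have mA : measurable [set x | e <= f x].
  have := measurable_fun_ler (measurable_cst e) mf; move=> /(_ measurableT [set true]).
  by rewrite setTI; exact.
have [e0|e0] := leP 0 e; last first.
  apply: (@le_trans _ _ 0%E); last by apply: integral_ge0 => x _; rewrite lee_fin.
  by rewrite mule_le0_ge0// lee_fin ltW.
have <- : (\int[P]_(x in [set x | (e <= f x)%R]) (cst e%:E x) = e%:E * P [set x | (e <= f x)%R])%E.
  exact: integral_cst.
rewrite integral_mkcond; apply: ge0_le_integral => //.
- by move=> x _; rewrite patchE; case: ifP; rewrite ?lee_fin.
- by apply/(measurable_restrictT _ mA).1 => //; exact: measurable_cst.
- exact: measurableT_comp.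
- move=> x _; rewrite patchE; case: ifPn => [|_]; last by rewrite lee_fin.
  by rewrite inE /= lee_fin.
Qed.

Lemma measurable_set_le (e : R) (f : T -> R) : measurable_fun setT f -> measurable [set x | e <= f x].
Proof.
move=> mf; have := measurable_fun_ler (measurable_cst e) mf; move=> /(_ measurableT [set true]).
by rewrite setTI; exact.
Qed.

Lemma le_measure_ae (A B : set T) : measurable A -> measurable B ->
  {ae P, forall x, A x -> B x} -> (P A <= P B)%E.
Proof.
move=> mA mB AB; have mAB : measurable (A `\` B) by exact: measurableD.
have -> : P A = (P (A `\` B) + P (A `&` B))%E by exact: measureDI.
rewrite (_ : P (A `\` B) = 0%E).
  by rewrite add0e; apply: le_measure; rewrite ?inE//; exact: measurableI.
apply: measure_negligible => //; move: AB => [N [mN N0 sN]]; exists N; split=> //.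
by apply: subset_trans sN => x [Ax nBx] /(_ Ax).
Qed.

(** The inverse, with value 0 at 0, is f times the power -1 of f^2; the real power is a measurable
    function and the factor f restores the value at 0. *)
Lemma measurable_funV (f : T -> R) : measurable_fun setT f -> measurable_fun setT (fun x => (f x)^-1).
Proof.
move=> mf; rewrite (_ : (fun x => _) = fun x => f x * (f x ^+ 2) `^ (-1)).
  apply: measurable_funM => //; apply: (measurableT_comp (measurable_powR _)).
  exact: measurable_funX.
apply/funext => x; rewrite powR_inv1 ?sqr_ge0//.
have [->|fx0] := eqVneq (f x) 0; first by rewrite mul0r invr0.
by field.
Qed.

(* The complement of [-K, K] is covered by countably many rational intervals of probability zero. *)
Lemma rv_support_bounded (Z : {RV P >-> R}) (K : R) :
  rv_support Z `<=` [set z | `|z| <= K] -> {ae P, forall x, `|Z x| <= K}.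
Proof.
move=> ZK.
pose J (q : rat * rat) : set T := Z @^-1` `]ratr q.1, ratr q.2[%classic.
have mJ q : measurable (J q) by rewrite -[J q]setTI; exact: measurable_funP.
pose F n : set T := if unpickle n is Some q then (if P (J q) == 0%E then J q else set0) else set0.
have nF n : P.-negligible (F n).
  rewrite /F; case: unpickle => [q|]; last exact: negligible_set0.
  by case: ifPn => [/eqP Pq|_]; [exact/negligibleP|exact: negligible_set0].
have : P.-negligible (\bigcup_n F n) by exact: negligible_bigcup.
apply: negligibleS => x /= /negP; rewrite -ltNge => KZ.
have : ~ rv_support Z (Z x) by move=> /ZK /=; rewrite leNgt KZ.
move=> /existsNP[e /not_implyP[e0 Pe]].
have [q1] := @rat_in_itvoo _ (Z x - e) (Z x) ltac:(by rewrite gtrBl).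
have [q2] := @rat_in_itvoo _ (Z x) (Z x + e) ltac:(by rewrite ltrDl).
rewrite !in_itv/= => /andP[q2a q2b] /andP[q1a q1b].
have PJ : P (J (q1, q2)) = 0%E.
  have JB : (P (J (q1, q2)) <= P (Z @^-1` ball (Z x) e))%E.
    apply: le_measure; rewrite ?inE//.
      by rewrite -[X in measurable X]setTI; apply: measurable_funP => //; exact: measurable_ball.
    move=> y; rewrite /J /= in_itv/= => /andP[y1 y2].
    by rewrite /ball/= ltr_distlC; apply/andP; split; lra.
  apply/eqP; rewrite eq_le measure_ge0 andbT; apply: le_trans JB _.
  by rewrite leNgt; apply/negP.
have FE : F (pickle (q1, q2)) = J (q1, q2) by rewrite /F pickleK PJ eqxx.
exists (pickle (q1, q2)); first exact: Logic.I.
by rewrite FE /J /= in_itv/= q1b q2a.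
Qed.

End probability_bounds.

Section sequences.
Context (d : nat -> measure_display) (T : forall S, measurableType (d S)).
Context (P : forall S, probability (T S) R).
Implicit Types Z : forall S, T S -> R.

Lemma cvg_in_prob_sqr Z (c : R) (v : nat -> \bar R) : 0 <= c ->
  (forall S, measurable_fun setT (Z S)) ->
  (forall S, \int[P S]_x (Z S x ^+ 2)%:E <= c%:E * v S)%E ->
  v S @[S --> \oo] --> 0%E -> cvg_in_prob P Z 0.
Proof.
move=> c0 mZ Zv v0 e e0.
have e20 : 0 < e ^+ 2 by rewrite exprn_gt0.
have cv0 : (((e ^+ 2)^-1 * c)%:E * v S)%E @[S --> \oo] --> 0%E.
  by rewrite -(mule0 ((e ^+ 2)^-1 * c)%:E); exact: cvgeZl.
apply: (squeeze_cvge0 _ _ cv0) => [S|S]; first exact: measure_ge0.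
rewrite EFinM -muleA lee_pdivlMl//; apply: le_trans (Zv S).
have -> : [set x | e <= `|Z S x - 0|] = [set x | e ^+ 2 <= Z S x ^+ 2].
  apply/seteqP; split=> x /=; rewrite subr0 -(real_normK (num_real (Z S x)));
    by rewrite ler_pXn2r// nnegrE// ltW.
by apply: markov_ge0 => [|x]; [exact: measurable_funX|exact: sqr_ge0].
Qed.

(** The decomposition may depend on the tolerance: [Z2] need not converge, it is only small in mean
    uniformly in [S]. This is the situation of a truncation level fixed before [S] grows. *)
Lemma cvg_in_prob_approx Z : (forall S, measurable_fun setT (Z S)) ->
  (forall eta : R, 0 < eta -> exists Z1 Z2 : forall S, T S -> R,
    [/\ forall S, measurable_fun setT (Z1 S), forall S, measurable_fun setT (Z2 S),
        forall S x, Z S x = Z1 S x + Z2 S x, cvg_in_prob P Z1 0 &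
        forall S, (\int[P S]_x `|Z2 S x|%:E <= eta%:E)%E]) ->
  cvg_in_prob P Z 0.
Proof.
move=> mZ approx e e0; apply: cvge0_le => // r r0.
have e2 : 0 < e / 2 by rewrite divr_gt0.
(* With this tolerance Markov's inequality bounds the probability of [|Z2| >= e / 2] by [r / 2]. *)
have [|Z1 [Z2 [m1 m2 ZE c1 I2]]] := approx (e / 2 * (r / 2)); first by rewrite mulr_gt0// divr_gt0.
have r2 : 0 < r / 2 by rewrite divr_gt0.
have := near_le_cvge0 (fun S => measure_ge0 (P S) _) (c1 _ e2) r2; apply: filterS => S P1.
have ma : measurable_fun setT (fun x => `|Z1 S x - 0|).
  by apply: measurableT_comp => //; exact: measurable_funB.
have mb : measurable_fun setT (fun x => `|Z2 S x|) by exact: measurableT_comp.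
have mc : measurable_fun setT (fun x => `|Z S x - 0|).
  by apply: measurableT_comp => //; exact: measurable_funB.
have mA := measurable_set_le (e / 2) ma; have mB := measurable_set_le (e / 2) mb.
have mE := measurable_set_le e mc.
apply: (@le_trans _ _ (P S ([set x | e / 2 <= `|Z1 S x - 0|] `|` [set x | e / 2 <= `|Z2 S x|]))).
  apply: le_measure; rewrite ?inE//; first exact: measurableU.
  move=> x /=; rewrite !subr0 ZE => le.
  have [|lt1] := leP (e / 2) `|Z1 S x|; first by left.
  by right; have := ler_normD (Z1 S x) (Z2 S x); lra.
apply: le_trans (measureU2 _ _ _) _ => //.
rewrite [r](_ : _ = r / 2 + r / 2); last by field.
rewrite EFinD; apply: leeD => //.
have := markov_ge0 (P S) (e / 2) mb (fun x => normr_ge0 _).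
move=> /le_trans /(_ (I2 S)); by rewrite [(e / 2 * (r / 2))%:E]EFinM lee_pmul2l// lte_fin.
Qed.

(** Continuous mapping at the origin, with a modulus uniform in [S]. It serves both for the sum of
    the three error forms and for the final ratio. *)
Lemma cvg_in_prob_continuous Z Z1 Z2 Z3 :
  (forall S, measurable_fun setT (Z S)) -> (forall S, measurable_fun setT (Z1 S)) ->
  (forall S, measurable_fun setT (Z2 S)) -> (forall S, measurable_fun setT (Z3 S)) ->
  cvg_in_prob P Z1 0 -> cvg_in_prob P Z2 0 -> cvg_in_prob P Z3 0 ->
  (forall e : R, 0 < e -> exists2 r : R, 0 < r & forall S, {ae P S, forall x,
     `|Z1 S x| < r -> `|Z2 S x| < r -> `|Z3 S x| < r -> `|Z S x| < e}) ->
  cvg_in_prob P Z 0.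
Proof.
move=> mZ m1 m2 m3 c1 c2 c3 cont e e0.
have [r r0 Zr] := cont e e0.
have mn (f : forall S, T S -> R) (a : R) S : measurable_fun setT (f S) ->
    measurable [set x | a <= `|f S x - 0|].
  by move=> mf; apply: measurable_set_le; apply: measurableT_comp => //; exact: measurable_funB.
have mA := mn _ r _ (m1 _); have mB := mn _ r _ (m2 _); have mC := mn _ r _ (m3 _).
have mE := mn _ e _ (mZ _).
have c12 := cvgeD (erefl : (0 +? 0)%E) (c1 r r0) (c2 r r0); rewrite adde0 in c12.
have c0 : (P S [set x | (r <= `|Z1 S x - 0|)%R] + P S [set x | (r <= `|Z2 S x - 0|)%R] +
    P S [set x | (r <= `|Z3 S x - 0|)%R])%E @[S --> \oo] --> 0%E.
  by rewrite -[X in _ --> X]adde0; apply: cvgeD (c3 r r0) => //; exact: c12.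
apply: (squeeze_cvge0 _ _ c0) => [S|S]; first exact: measure_ge0.
apply: (@le_trans _ _ (P S (([set x | r <= `|Z1 S x - 0|] `|` [set x | r <= `|Z2 S x - 0|]) `|`
    [set x | r <= `|Z3 S x - 0|]))).
  apply: le_measure_ae => //; first by do 2 (apply: measurableU => //).
  apply: filterS (Zr S) => x /=; rewrite !subr0 => h le.
  have [|l1] := leP r `|Z1 S x|; first by left; left.
  have [|l2] := leP r `|Z2 S x|; first by left; right.
  have [|l3] := leP r `|Z3 S x|; first by right.
  by move: (h l1 l2 l3); rewrite ltNge le.
apply: le_trans (measureU2 _ _ _) _ => //; first exact: measurableU.
by apply: leeD => //; exact: measureU2.
Qed.

End sequences.

(** Only the scaled denominator [n * b0] is close to a limit; [|a0| <= K * b0] takes the place of a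
    limit for [n * a0]. The scale [n] cancels in both ratios. *)
Lemma ratio_continuous (c K e : R) : 0 < c -> 0 <= K -> 0 < e ->
  exists2 r : R, 0 < r & forall n a b a0 b0 : R, 0 <= n -> `|a0| <= K * b0 ->
    `|n * a - n * a0| < r -> `|n * b - n * b0| < r -> `|n * b0 - c| < r ->
    `|a / b - a0 / b0| < e.
Proof.
move=> c0 K0 e0.
have k0 : 0 < 1 + K by lra.
(* Two errors below [c / 4] keep [n * b] above [c / 2]. The second term is the [r] with
   [r * (1 + K) = e * (c / 4)], where 1 accounts for the error of the numerator and [K] for that of
   the denominator. *)
exists (Num.min (c / 4) (e * c / (4 * (1 + K)))).
  by rewrite lt_min !divr_gt0// ?mulr_gt0//.
move=> n a b a0 b0 nge0 aK; rewrite !lt_min => /andP[_ ha] /andP[hb hb'] /andP[hc _].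
have q0 : 0 < n * b0 by move: hc; rewrite ltr_norml => /andP[h1 h2]; lra.
have q : c / 2 < n * b.
  by move: hc hb; rewrite !ltr_norml => /andP[h1 h2] /andP[h3 h4]; lra.
have qp : 0 < n * b by apply: lt_trans q; rewrite divr_gt0.
have n0 : n != 0 by apply: contraTneq qp => ->; rewrite mul0r ltxx.
have bn0 : b != 0 by apply: contraTneq qp => ->; rewrite mulr0 ltxx.
have b0n0 : b0 != 0 by apply: contraTneq q0 => ->; rewrite mulr0 ltxx.
have -> : a / b - a0 / b0 =
    ((n * a - n * a0) * (n * b0) - (n * a0) * (n * b - n * b0)) / ((n * b) * (n * b0)).
  by field; rewrite n0 bn0 b0n0.
set r := e * c / (4 * (1 + K)) in ha hb'.
have rE : r * (1 + K) = e * (c / 4) by rewrite /r; field; rewrite gt_eqF.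
have na0 : `|n * a0| <= K * (n * b0).
  by rewrite normrM ger0_norm// mulrCA ler_wpM2l.
have bb0 : 0 < n * b * (n * b0) by rewrite mulr_gt0.
rewrite normrM normfV (gtr0_norm bb0) ltr_pdivrMr//.
apply: le_lt_trans (ler_normB _ _) _; rewrite [`|(n * a - n * a0) * (n * b0)|]normrM
  [`|n * a0 * (n * b - n * b0)|]normrM (gtr0_norm q0).
have h1 : `|n * a - n * a0| * (n * b0) < r * (n * b0) by rewrite ltr_pM2r.
have h2 : `|n * a0| * `|n * b - n * b0| <= K * (n * b0) * r by rewrite ler_pM// ltW.
have h3 : r * (n * b0) + K * (n * b0) * r = e * (c / 4) * (n * b0) by rewrite -rE; ring.
have h4 : e * (c / 4) * (n * b0) <= e * (n * b * (n * b0)).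
  by rewrite -mulrA ler_pM2l// ler_pM2r//; lra.
lra.
Qed.

End limits_in_probability.

Unset Implicit Arguments.

(** * The error of the numerator *)

Section triangular_array.
Context (R : realType) (N : nat -> nat).
Context (d : nat -> measure_display) (T : forall S, measurableType (d S)).
Context (P : forall S, probability (T S) R).
Variables (G gW : forall S, set (set (T S))).
Hypothesis mG : forall S A, G S A -> measurable A.
Hypothesis gWG : forall S A, <<s gW S >> A -> <<s G S >> A.
Variables (X : forall S, 'I_S -> {RV (P S) >-> R}).
Hypothesis X_indep : forall S, cond_independent (G S) (X S).
Hypothesis X_mean0 : forall S s, {ae P S, forall x, condE (P S) (G S) (X S s) x = 0}.
Variables (nu KX KY K : R).
Hypothesis nu_gt0 : 0 < nu.
Hypothesis X_int : forall S s, (P S).-integrable setT (EFin \o (fun x => `|X S s x| `^ (2 + nu))).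
Hypothesis X_bound : forall S s,
  {ae P S, forall x, condE (P S) (G S) (fun y => `|X S s y| `^ (2 + nu)) x <= KX}.
Variables (w b : forall S, 'I_(N S) -> 'I_S -> T S -> R) (Y0 : forall S, 'I_(N S) -> T S -> R).
Hypothesis mw : forall S i s, measurable_fun [set: g_sigma_algebraType (gW S)] (w S i s).
Hypothesis w_ge0 : forall S i s x, 0 <= w S i s x.
Hypothesis w_le1 : forall S i x, \sum_s w S i s x <= 1.
Hypothesis mb : forall S i s, measurable_fun [set: g_sigma_algebraType (G S)] (b S i s).
Hypothesis K_ge0 : 0 <= K.
Hypothesis bK : forall S i s x, `|b S i s x| <= K.
Hypothesis mY0 : forall S i, measurable_fun [set: g_sigma_algebraType (G S)] (Y0 S i).
Hypothesis Y0_sqi : forall S i, sqi (P S) (Y0 S i).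
Hypothesis Y0_bound : forall S i,
  {ae P S, forall x, condE (P S) (gW S) (fun y => Y0 S i y ^+ 2) x <= KY}.
Hypothesis concentration_cvg0 :
  (\int[P S]_x (concentration (fun i s => w S i s x))%:E)%E @[S --> \oo] --> 0%E.

Let cross S s t x := cross_coef (fun i s => w S i s x) (fun i s => b S i s x) s t.
Let lin S s x := linear_coef (fun i s => w S i s x) (Y0 S ^~ x) s.

Let cvg_linear : cvg_in_prob P (fun S x => \sum_s lin S s x * X S s x) 0.
Proof.
have h S := integral_linear (mG S) (gWG S) (X_indep S) (X_mean0 S) nu_gt0
  (X_int S) (X_bound S) (mw S) (w_ge0 S) (w_le1 S)
  (mY0 S) (Y0_sqi S) (Y0_bound S).
apply: (cvg_in_prob_sqr (c := (1 + `|KX|) * `|KY|) _ _ _ concentration_cvg0).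
- by rewrite mulr_ge0// addr_ge0.
- by move=> S; have [[mZ _] _] := h S.
- by move=> S; have [_] := h S.
Qed.

Let cvg_off_diagonal : cvg_in_prob P
  (fun S x => \sum_s \sum_(t | t != s) cross S s t x * X S s x * X S t x) 0.
Proof.
have h S := integral_cross_off_diagonal (mG S) (gWG S) (X_indep S)
  (X_mean0 S) nu_gt0 (X_int S) (X_bound S) (mw S) (w_ge0 S)
  (w_le1 S) (mb S) K_ge0 (bK S).
apply: (cvg_in_prob_sqr (c := 4 * (1 + `|KX|) ^+ 2 * K ^+ 2) _ _ _ concentration_cvg0).
- by rewrite !mulr_ge0 ?sqr_ge0.
- by move=> S; have [[mZ _] _] := h S.
- by move=> S; have [_] := h S.
Qed.

Let cvg_diagonal : cvg_in_prob P
  (fun S x => \sum_s cross S s s x * (X S s x ^+ 2 - sigma2 (G S) (X S) s x)) 0.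
Proof.
have h1 S k k0 := integral_cross_truncated (mG S) (gWG S) (X_indep S)
  (mw S) (w_ge0 S)
  (w_le1 S) (mb S) K_ge0 (bK S) (k := k) k0.
have h2 S k k0 := integral_cross_tail (mG S) (gWG S) (X_indep S)
  nu_gt0 (X_int S) (X_bound S) (mw S) (w_ge0 S)
  (w_le1 S) (mb S) K_ge0 (bK S) (k := k) k0.
pose Z1 k S x := \sum_s cross S s s x * truncated_innovation (G S) (X S) k s x.
pose Z2 k S x := \sum_s cross S s s x * tail_innovation (G S) (X S) k s x.
have m1 k S : 0 < k -> measurable_fun setT (Z1 k S).
  by move=> k0; have [[mZ _] _] := h1 S k k0.
have m2 k S : 0 < k -> measurable_fun setT (Z2 k S).
  by move=> k0; have [mZ _] := h2 S k k0.
have ZE k S x : \sum_s cross S s s x * (X S s x ^+ 2 - sigma2 (G S) (X S) s x) =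
    Z1 k S x + Z2 k S x.
  exact: (truncation_split (G S) (X S) (fun s x => cross S s s x) k x).
apply: cvg_in_prob_approx => [S|eta eta0].
  (* Any positive truncation level gives measurability; 1 is an arbitrary choice. *)
  under eq_fun do rewrite (ZE 1).
  by apply: measurable_funD; [exact: m1|exact: m2].
(* The tail is at most 2 k^(-nu) |KX| K in mean. The level [k] solves k^(-nu) = a, which brings this
   below [eta]; the added 1 keeps the denominator of [a] positive. *)
have D0 : 0 < 2 * `|KX| * K + 1 by rewrite ltr_wpDl// !mulr_ge0.
pose a := eta / (2 * `|KX| * K + 1).
have a0 : 0 < a by rewrite divr_gt0.
pose k := a `^ (- nu^-1).
have k0 : 0 < k by rewrite powR_gt0.
have kE : k `^ (- nu) = a.
  by rewrite /k -powRrM mulrNN mulVf ?gt_eqF// powRr1// ltW.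
exists (Z1 k), (Z2 k); split=> //.
- by move=> S; exact: m1.
- by move=> S; exact: m2.
- apply: (cvg_in_prob_sqr (c := k ^+ 4 * K ^+ 2) _ _ _ concentration_cvg0).
  + by rewrite mulr_ge0 ?sqr_ge0// exprn_ge0// ltW.
  + by move=> S; exact: m1.
  + by move=> S; have [_] := h1 S k k0.
- move=> S; have [_ /le_trans] := h2 S k k0; apply.
  rewrite kE lee_fin /a.
  rewrite (_ : 2 * _ * _ * _ = eta * ((2 * `|KX| * K) / (2 * `|KX| * K + 1))); last by ring.
  apply: ler_piMr; first exact: ltW.
  by rewrite ler_pdivrMr// mul1r lerDl.
Qed.

Let m_linear S : measurable_fun setT (fun x => \sum_s lin S s x * X S s x).
Proof.
by have [[]] := integral_linear (mG S) (gWG S) (X_indep S) (X_mean0 S) nu_gt0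
  (X_int S) (X_bound S) (mw S) (w_ge0 S) (w_le1 S)
  (mY0 S) (Y0_sqi S) (Y0_bound S).
Qed.

Let m_off_diagonal S :
  measurable_fun setT (fun x => \sum_s \sum_(t | t != s) cross S s t x * X S s x * X S t x).
Proof.
by have [[]] := integral_cross_off_diagonal (mG S) (gWG S) (X_indep S)
  (X_mean0 S) nu_gt0 (X_int S) (X_bound S) (mw S) (w_ge0 S)
  (w_le1 S) (mb S) K_ge0 (bK S).
Qed.

Let m_diagonal S : measurable_fun setT
  (fun x => \sum_s cross S s s x * (X S s x ^+ 2 - sigma2 (G S) (X S) s x)).
Proof.
under eq_fun do rewrite (truncation_split (G S) (X S) (fun s x => cross S s s x) 1).
apply: measurable_funD.
  by have [[]] := integral_cross_truncated (mG S) (gWG S) (X_indep S)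
    (mw S) (w_ge0 S)
    (w_le1 S) (mb S) K_ge0 (bK S) (k := 1) ltr01.
by have [] := integral_cross_tail (mG S) (gWG S) (X_indep S)
  nu_gt0 (X_int S) (X_bound S) (mw S) (w_ge0 S)
  (w_le1 S) (mb S) K_ge0 (bK S) (k := 1) ltr01.
Qed.

Definition numerator_error S x :=
  (N S)%:R^-1 * (\sum_i (\sum_s w S i s x * X S s x) *
    (Y0 S i x + \sum_t (w S i t x * b S i t x) * X S t x)) -
  (N S)%:R^-1 * (\sum_i \sum_s w S i s x * (w S i s x * b S i s x) * sigma2 (G S) (X S) s x).

Let numerator_errorE S x : numerator_error S x =
  \sum_s lin S s x * X S s x +
  \sum_s \sum_(t | t != s) cross S s t x * X S s x * X S t x +
  \sum_s cross S s s x * (X S s x ^+ 2 - sigma2 (G S) (X S) s x).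
Proof.
exact: (shift_share_split (fun i s => w S i s x) (fun i s => b S i s x) (Y0 S ^~ x)
  (fun s => X S s x) (fun s => sigma2 (G S) (X S) s x)).
Qed.

Lemma measurable_numerator_error S : measurable_fun setT (numerator_error S).
Proof.
rewrite (funext (numerator_errorE S)).
by apply: measurable_funD => //; exact: measurable_funD.
Qed.

Lemma cvg_numerator_error : cvg_in_prob P numerator_error 0.
Proof.
apply: (cvg_in_prob_continuous measurable_numerator_error m_linear m_off_diagonal m_diagonal
  cvg_linear cvg_off_diagonal cvg_diagonal) => e e0.
exists (e / 3) => [|S]; first by rewrite divr_gt0.
apply: aeW => x; rewrite numerator_errorE => h1 h2 h3.
apply: le_lt_trans (ler_normD _ _) _; apply: le_lt_trans (lerD (ler_normD _ _) (lexx _)) _.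
lra.
Qed.

End triangular_array.

Set Implicit Arguments.

(** * Replacing the data by everywhere bounded versions *)

(** If [f] has no version, [condE] takes its constant default, which is measurable too; hence the
    estimand is measurable whatever the integrands. *)
Lemma measurable_condE_ambient d (T : measurableType d) (R : realType) (P : probability T R)
    (G : set (set T)) (f : T -> R) :
  (forall A, G A -> measurable A) -> measurable_fun setT (condE P G f).
Proof.
move=> mG; rewrite /condE; case: xgetP => [g _ [_ mg _ _]|_]; last exact: measurable_cst.
exact: (sub_measurable_fun (sub_sigma_measurable mG) mg).
Qed.

Section row_identities.
Context d (T : measurableType d) (R : realType) (P : probability T R).
Variables (N n : nat) (Y Y0 : 'I_N -> {RV P >-> R}) (b w : 'I_N -> 'I_n -> {RV P >-> R}).
Variables (X : 'I_n -> {RV P >-> R}).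

Lemma gen_W_measurable A : gen_W w A -> measurable A.
Proof. by move=> [i _ [s _ [B mB <-]]]; exact: (measurable_funP (w i s)). Qed.

Lemma gen_F0_measurable A : gen_F0 Y0 b w A -> measurable A.
Proof.
move=> [[[i _ [B mB <-]]|[i _ [s _ [B mB <-]]]]|/gen_W_measurable//].
  exact: (measurable_funP (Y0 i)).
exact: (measurable_funP (b i s)).
Qed.

Lemma gen_W_F0 A : <<s gen_W w >> A -> <<s gen_F0 Y0 b w >> A.
Proof.
move: A; apply: smallest_sub; first exact: smallest_sigma_algebra.
by move=> A wA; apply: sub_sigma_algebra; right.
Qed.

Lemma measurable_gen_W i s : measurable_fun [set: g_sigma_algebraType (gen_W w)] (w i s).
Proof. by move=> _ B mB; apply: sub_sigma_algebra; exists i => //; exists s => //; exists B. Qed.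

Lemma measurable_gen_F0_Y0 i : measurable_fun [set: g_sigma_algebraType (gen_F0 Y0 b w)] (Y0 i).
Proof. by move=> _ B mB; apply: sub_sigma_algebra; left; left; exists i => //; exists B. Qed.

Lemma measurable_gen_F0_b i s : measurable_fun [set: g_sigma_algebraType (gen_F0 Y0 b w)] (b i s).
Proof.
by move=> _ B mB; apply: sub_sigma_algebra; left; right; exists i => //; exists s => //; exists B.
Qed.

(* The weights are nonnegative with row sums at most 1 only almost surely. They are set to 0
   off [proper_weights], an event of the sigma-algebra of [w] alone, so that the moment bound
   given [gen_W w] still applies to them. *)
Definition proper_weights : set T :=
  (\bigcap_(i in [set: 'I_N]) \bigcap_(s in [set: 'I_n]) [set x | 0 <= w i s x]) `&`
  (\bigcap_(i in [set: 'I_N]) [set x | \sum_s w i s x <= 1]).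

Definition clip_w i s x := \1_proper_weights x * w i s x.

(** A bounded support bounds the effects only almost surely; clipping gives an everywhere bounded
    version measurable for the same sigma-algebra. *)
Definition clip_b (K : R) i s x := Num.max (- K) (Num.min K (b i s x)).

Lemma proper_weights_gen_W : <<s gen_W w >> proper_weights.
Proof.
have mle (f g : g_sigma_algebraType (gen_W w) -> R) : measurable_fun setT f ->
    measurable_fun setT g -> measurable [set x | f x <= g x].
  move=> mf mg; have := measurable_fun_ler mf mg; move=> /(_ measurableT [set true]).
  by rewrite setTI; exact.
apply: (@measurableI _ (g_sigma_algebraType (gen_W w))).
  apply: (@fin_bigcap_measurable _ (g_sigma_algebraType (gen_W w))) => // i _.
  apply: (@fin_bigcap_measurable _ (g_sigma_algebraType (gen_W w))) => // s _.
  by apply: mle => //; exact: measurable_gen_W.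
apply: (@fin_bigcap_measurable _ (g_sigma_algebraType (gen_W w))) => // i _.
by apply: mle => //; apply: measurable_sum => s; exact: measurable_gen_W.
Qed.

Lemma measurable_clip_w i s : measurable_fun [set: g_sigma_algebraType (gen_W w)] (clip_w i s).
Proof.
apply: measurable_funM; last exact: measurable_gen_W.
apply: (@measurable_indic _ (g_sigma_algebraType (gen_W w))); exact: proper_weights_gen_W.
Qed.

Lemma measurable_clip_b K i s :
  measurable_fun [set: g_sigma_algebraType (gen_F0 Y0 b w)] (clip_b K i s).
Proof.
by apply: measurable_maxr => //; apply: measurable_minr => //; exact: measurable_gen_F0_b.
Qed.

Lemma clip_w_proper i s x : proper_weights x -> clip_w i s x = w i s x.
Proof. by move=> px; rewrite /clip_w indicE mem_set// mul1r. Qed.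

Lemma clip_w_improper i s x : ~ proper_weights x -> clip_w i s x = 0.
Proof. by move=> px; rewrite /clip_w indicE memNset// mul0r. Qed.

Lemma clip_w_ge0 i s x : 0 <= clip_w i s x.
Proof.
have [px|px] := pselect (proper_weights x); last by rewrite clip_w_improper.
by rewrite clip_w_proper//; have [/(_ i Logic.I s Logic.I)] := px.
Qed.

Lemma clip_w_le1 i x : \sum_s clip_w i s x <= 1.
Proof.
have [px|px] := pselect (proper_weights x).
  under eq_bigr do rewrite clip_w_proper//.
  by have [_ /(_ i Logic.I)] := px.
by rewrite big1 ?ler01// => s _; rewrite clip_w_improper.
Qed.

Lemma clip_w_norm i s x : `|clip_w i s x| <= 1.
Proof.
rewrite ger0_norm ?clip_w_ge0//; apply: (weight_le1 (w := fun i s => clip_w i s x)).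
  by move=> ? ?; exact: clip_w_ge0.
by move=> ?; exact: clip_w_le1.
Qed.

Lemma clip_b_le (K : R) i s x : 0 <= K -> `|clip_b K i s x| <= K.
Proof.
by move=> K0; rewrite ler_norml le_max lexx/= ge_max ge_min lexx/= andbT; lra.
Qed.

Lemma clip_b_id (K : R) i s x : `|b i s x| <= K -> clip_b K i s x = b i s x.
Proof. by rewrite ler_norml /clip_b => /andP[h1 h2]; rewrite (min_idPr h2) (max_idPr h1). Qed.

(** Off [proper_weights] the left-hand side is 0 whereas the share of unrestricted weights may be
    negative; the absolute value makes the bound hold at every point. *)
Lemma concentration_clip_le x :
  concentration (fun i s => clip_w i s x) <= `|max_sector_share w x|.
Proof.
have [px|px] := pselect (proper_weights x).
  have := @concentration_le_share _ _ _ (fun i s => clip_w i s x)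
    (fun i s => clip_w_ge0 i s x) (fun i => clip_w_le1 i x).
  move=> /le_trans; apply; apply: le_trans (ler_norm _); rewrite /max_sector_share /size_sector.
  have e s : \sum_i clip_w i s x = \sum_i w i s x by apply: eq_bigr => i _; rewrite clip_w_proper.
  by under eq_bigr do rewrite e; under [X in _ / X <= _]eq_bigr do rewrite e.
rewrite /concentration big1 ?mulr0// => s _; rewrite big1 ?expr0n//.
by move=> i _; rewrite clip_w_improper.
Qed.

Hypothesis w_ge0 : forall i s, {ae P, forall x, 0 <= w i s x}.
Hypothesis w_le1 : forall i, {ae P, forall x, \sum_(s < n) w i s x <= 1}.
Hypothesis outcome : forall i, {ae P, forall x,
  Y i x = Y0 i x + \sum_(s < n) w i s x * X s x * b i s x}.
Local Notation F := (gen_F0 Y0 b w).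
Hypothesis X_mean0 : forall s, {ae P, forall x, condE P F (X s) x = 0}.
Hypothesis X_indep : cond_independent F X.
Variables (nu KX Kb : R).
Hypothesis b_bounded : forall i s, rv_support (b i s) `<=` [set z | `|z| <= Kb].
Hypothesis nu_gt0 : 0 < nu.
Hypothesis X_int : forall s, P.-integrable setT (EFin \o (fun x => `|X s x| `^ (2 + nu))).
Hypothesis X_bound : forall s, {ae P, forall x, condE P F (fun y => `|X s y| `^ (2 + nu)) x <= KX}.
Hypothesis Y0_int : forall i, P.-integrable setT (EFin \o (fun x => Y0 i x ^+ 2)).

Let K := `|Kb|.
Let w' := clip_w.
Let b' := clip_b K.
Let sig := sigma2 F X.
Let mF := gen_F0_measurable.

Lemma proper_weights_ae : {ae P, forall x, proper_weights x}.
Proof.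
have h1 : {ae P, forall x, forall i s, 0 <= w i s x}.
  by apply: filter_forall => i; apply: filter_forall => s.
have h2 : {ae P, forall x, forall i, \sum_s w i s x <= 1} by exact: filter_forall.
by apply: filterS2 h1 h2 => x h1 h2; split=> i _ => [s _|]; [exact: h1|exact: h2].
Qed.

Lemma clip_b_ae : {ae P, forall x, forall i s, b' i s x = b i s x}.
Proof.
apply: filter_forall => i; apply: filter_forall => s.
apply: filterS (rv_support_bounded (@b_bounded i s)) => x bx.
by apply: clip_b_id; apply: le_trans bx (ler_norm _).
Qed.

Let mw'F i s : measurable_fun [set: g_sigma_algebraType F] (w' i s).
Proof. by move=> _ B mB; apply: gen_W_F0; exact: (@measurable_clip_w i s measurableT B mB). Qed.

Definition clipped_XY i x :=
  (\sum_s w' i s x * X s x) * (Y0 i x + \sum_t (w' i t x * b' i t x) * X t x).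

(** The summand 0 and the factor 1 are kept so that this is literally the numerator with zero
    baseline outcome and unit effects, as in [numerator_error]. *)
Definition clipped_XX i x :=
  (\sum_s w' i s x * X s x) * (0 + \sum_t (w' i t x * 1) * X t x).

Lemma clipped_XY_ae : {ae P, forall x, forall i, shifter w X i x * Y i x = clipped_XY i x}.
Proof.
have ho : {ae P, forall x, forall i,
  Y i x = Y0 i x + \sum_(s < n) w i s x * X s x * b i s x} by exact: filter_forall.
apply: filterS3 ho proper_weights_ae clip_b_ae => x ho px bx i.
rewrite /clipped_XY ho /shifter; congr (_ * (_ + _)).
  by apply: eq_bigr => s _; rewrite /w' clip_w_proper.
by apply: eq_bigr => s _; rewrite /w' clip_w_proper// bx mulrAC.
Qed.

Lemma clipped_XX_ae : {ae P, forall x, forall i, shifter w X i x ^+ 2 = clipped_XX i x}.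
Proof.
apply: filterS proper_weights_ae => x px i.
rewrite /clipped_XX add0r expr2 /shifter; congr (_ * _).
  by apply: eq_bigr => s _; rewrite /w' clip_w_proper.
by apply: eq_bigr => s _; rewrite /w' clip_w_proper// mulr1.
Qed.

Let mshifter i : measurable_fun setT (shifter w X i).
Proof. by apply: measurable_sum => s; exact: measurable_funM. Qed.

Lemma condE_XY_ae i : {ae P, forall x, condE P F (fun y => shifter w X i y * Y i y) x =
  \sum_s w' i s x * (w' i s x * b' i s x) * sig s x}.
Proof.
have K0 : 0 <= K by exact: normr_ge0.
have sY : sqi P (Y0 i) by split.
have mh s : measurable_fun [set: g_sigma_algebraType F] (fun x => w' i s x * b' i s x).
  by apply: measurable_funM => //; exact: measurable_clip_b.
have vM s x : `|w' i s x| <= Num.max 1 K by rewrite le_max clip_w_norm.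
have hM s x : `|w' i s x * b' i s x| <= Num.max 1 K.
  rewrite le_max normrM -[X in _ || (_ <= X)]mul1r ler_pM ?orbT// ?clip_w_norm//.
  exact: clip_b_le.
have [IQ Q] := condE_shifter_product mF X_indep X_mean0 nu_gt0 X_int X_bound
  (mw'F i) mh (measurable_gen_F0_Y0 i) vM hM sY.
have mf : measurable_fun setT (fun y => shifter w X i y * Y i y) by exact: measurable_funM.
have e : {ae P, forall y, shifter w X i y * Y i y = clipped_XY i y}.
  by apply: filterS clipped_XY_ae => y h; exact: h.
by apply: filterS2 (condE_ae_eq mF mf e IQ) Q => x -> ->.
Qed.

Lemma condE_XX_ae i : {ae P, forall x, condE P F (fun y => shifter w X i y ^+ 2) x =
  \sum_s w' i s x * (w' i s x * 1) * sig s x}.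
Proof.
have mh s : measurable_fun [set: g_sigma_algebraType F] (fun x => w' i s x * 1).
  exact: measurable_funM.
have vM s x : `|w' i s x| <= 1 by rewrite clip_w_norm.
have hM s x : `|w' i s x * 1| <= 1 by rewrite mulr1 clip_w_norm.
have my : measurable_fun [set: g_sigma_algebraType F] (cst 0 : T -> R) by exact: measurable_cst.
have [IQ Q] := condE_shifter_product mF X_indep X_mean0 nu_gt0 X_int X_bound
  (mw'F i) mh my vM hM (sqi0 P).
have mf : measurable_fun setT (fun y => shifter w X i y ^+ 2) by exact: measurable_funX.
have e : {ae P, forall y, shifter w X i y ^+ 2 = clipped_XX i y}.
  by apply: filterS clipped_XX_ae => y h; exact: h.
by apply: filterS2 (condE_ae_eq mF mf e IQ) Q => x -> ->.
Qed.

Let A x := \sum_i clipped_XY i x.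
Let B x := \sum_i clipped_XX i x.
Let A0 x := \sum_i \sum_s w' i s x * (w' i s x * b' i s x) * sig s x.
Let B0 x := \sum_i \sum_s w' i s x * (w' i s x * 1) * sig s x.

Lemma estimand_clipped : {ae P, forall x, estimand F Y w X x = A0 x / B0 x}.
Proof.
have h1 : {ae P, forall x, forall i, condE P F (fun y => shifter w X i y * Y i y) x =
    \sum_s w' i s x * (w' i s x * b' i s x) * sig s x}.
  by apply: filter_forall => i; exact: condE_XY_ae.
have h2 : {ae P, forall x, forall i, condE P F (fun y => shifter w X i y ^+ 2) x =
    \sum_s w' i s x * (w' i s x * 1) * sig s x}.
  by apply: filter_forall => i; exact: condE_XX_ae.
apply: filterS2 h1 h2 => x h1 h2; rewrite /estimand /A0 /B0; congr (_ / _).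
  by apply: eq_bigr => i _; exact: h1.
by apply: eq_bigr => i _; exact: h2.
Qed.

Lemma beta_hat_clipped : {ae P, forall x, beta_hat Y w X x = A x / B x}.
Proof.
apply: filterS2 clipped_XY_ae clipped_XX_ae => x h1 h2; rewrite /beta_hat /A /B; congr (_ / _).
  by apply: eq_bigr => i _; exact: h1.
by apply: eq_bigr => i _; exact: h2.
Qed.

Let condVar_sig : {ae P, forall x, forall s, condVar P F (X s) x = sig s x}.
Proof. by apply: filter_forall => s; exact: (condVarE mF X_mean0 nu_gt0 X_int). Qed.

Lemma condVar_sum_clipped : {ae P, forall x,
  \sum_(i < N) \sum_(s < n) condVar P F (X s) x * w i s x ^+ 2 = B0 x}.
Proof.
apply: filterS2 condVar_sig proper_weights_ae => x hv px.
apply: eq_bigr => i _; apply: eq_bigr => s _.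
by rewrite hv /w' clip_w_proper// mulr1 mulrC expr2.
Qed.

Lemma weighted_ratio_clipped : {ae P, forall x,
  (\sum_(i < N) \sum_(s < n) pi_weight F w X i s x * b i s x) /
     \sum_(i < N) \sum_(s < n) pi_weight F w X i s x = A0 x / B0 x}.
Proof.
apply: filterS3 condVar_sig proper_weights_ae clip_b_ae => x hv px bx.
congr (_ / _); apply: eq_bigr => i _; apply: eq_bigr => s _.
  by rewrite /pi_weight hv /w' clip_w_proper// bx; ring.
by rewrite /pi_weight hv /w' clip_w_proper// mulr1 expr2.
Qed.

(** [A0] averages the clipped effects with the weights of [B0], which are nonnegative almost surely
    since [sig] is. This is the hypothesis [|a0| <= K * b0] of [ratio_continuous]. *)
Lemma clipped_le : {ae P, forall x, `|A0 x| <= K * B0 x}.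
Proof.
have sig0 : {ae P, forall x, forall s, 0 <= sig s x}.
  apply: filter_forall => s.
  have I0 := finite_measure_integrable_cst P 0 measurableT.
  have : {ae P, forall x, condE P F (cst 0) x <= sig s x}.
    by apply: (condE_le mF I0 (X2_integrable nu_gt0 X_int s)) => x; exact: sqr_ge0.
  by apply: filterS2 (condE_cst P mF 0) => x ->.
apply: filterS sig0 => x s0; rewrite /A0 /B0 mulr_sumr.
apply: le_trans (ler_norm_sum _ _ _) _; apply: ler_sum => i _; rewrite mulr_sumr.
apply: le_trans (ler_norm_sum _ _ _) _; apply: ler_sum => s _.
have h : `|b' i s x| <= K by apply: clip_b_le; exact: normr_ge0.
have w0 : 0 <= w' i s x by exact: clip_w_ge0.
move: (w' i s x) (b' i s x) (sig s x) (s0 s) w0 h => u v t t0 u0 h.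
rewrite mulr1 !normrM (ger0_norm t0) (ger0_norm u0).
rewrite (_ : K * _ = u * (u * K) * t); last by ring.
by rewrite ler_wpM2r// ler_wpM2l// ler_wpM2l.
Qed.

Lemma measurable_beta_hat : measurable_fun setT (beta_hat Y w X).
Proof.
apply: measurable_funM; first by apply: measurable_sum => i; exact: measurable_funM.
by apply: measurable_funV; apply: measurable_sum => i; exact: measurable_funX.
Qed.

Lemma measurable_estimand : measurable_fun setT (estimand F Y w X).
Proof.
have mc f : measurable_fun setT (condE P F f) by exact: measurable_condE_ambient.
apply: measurable_funM; first by apply: measurable_sum => i; exact: mc.
by apply: measurable_funV; apply: measurable_sum => i; exact: mc.
Qed.

End row_identities.

(** * The estimand formula and consistency *)

Unset Implicit Arguments.

Theorem proposition1 (R : realType)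
  (* S-th row: N S regions, S sectors, on the probability space (T S, P S) *)
  (N : nat -> nat)
  (d : nat -> measure_display) (T : forall S, measurableType (d S))
  (P : forall S, probability (T S) R)
  (Y Y0 : forall S, 'I_(N S) -> {RV (P S) >-> R})
  (b w : forall S, 'I_(N S) -> 'I_S -> {RV (P S) >-> R})
  (X : forall S, 'I_S -> {RV (P S) >-> R})
  (* joint realization of all rows, giving meaning to almost sure limits *)
  (dO : measure_display) (Omega : measurableType dO) (Q : probability Omega R)
  (row : forall S, {mfun Omega >-> T S})
  (rowP : forall S (A : set (T S)), measurable A -> Q (row S @^-1` A) = P S A)
  (w_ge0 : forall S i s, {ae P S, forall x, 0 <= w S i s x})
  (w_le1 : forall S i, {ae P S, forall x, \sum_(s < S) w S i s x <= 1})
  (F0 := fun S => gen_F0 (Y0 S) (b S) (w S))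
  (* (1) *)
  (outcome : forall S i, {ae P S, forall x,
     Y S i x = Y0 S i x + \sum_(s < S) w S i s x * X S s x * b S i s x})
  (* (2) *)
  (X_mean0 : forall S s, {ae P S, forall x, condE (P S) (F0 S) (X S s) x = 0})
  (* (3) *)
  (X_indep : forall S, cond_independent (F0 S) (X S))
  (* (4) *)
  (no_large_sector :
     {ae Q, forall o, max_sector_share (w S) (row S o) @[S --> \oo] --> (0 : R)})
  (* (5) *)
  (Kb : R)
  (b_bounded : forall S i s, rv_support (b S i s) `<=` [set z | `|z| <= Kb])
  (* (6) *)
  (c : R) (c_gt0 : 0 < c)
  (var_cvg : cvg_in_prob P (fun S x => (N S)%:R^-1 *
     \sum_(i < N S) \sum_(s < S) condVar (P S) (F0 S) (X S s) x * w S i s x ^+ 2)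
     c)
  (* (7) *)
  (nu KX KY : R) (nu_gt0 : 0 < nu)
  (X_moment : forall S s,
     (P S).-integrable [set: T S] (EFin \o (fun x => `|X S s x| `^ (2 + nu))) /\
     {ae P S, forall x,
        condE (P S) (F0 S) (fun y => `|X S s y| `^ (2 + nu)) x <= KX})
  (Y0_moment : forall S i,
     (P S).-integrable [set: T S] (EFin \o (fun x => Y0 S i x ^+ 2)) /\
     {ae P S, forall x,
        condE (P S) (gen_W (w S)) (fun y => Y0 S i y ^+ 2) x <= KY}) :
  (forall S, {ae P S, forall x, estimand (F0 S) (Y S) (w S) (X S) x =
     (\sum_(i < N S) \sum_(s < S) pi_weight (F0 S) (w S) (X S) i s x * b S i s x) /
     \sum_(i < N S) \sum_(s < S) pi_weight (F0 S) (w S) (X S) i s x}) /\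
  cvg_in_prob P (fun S x =>
     beta_hat (Y S) (w S) (X S) x - estimand (F0 S) (Y S) (w S) (X S) x) 0.
Proof.
have mF S := @gen_F0_measurable _ _ _ (P S) _ _ (Y0 S) (b S) (w S).
have X_int S s : (P S).-integrable setT (EFin \o (fun x => `|X S s x| `^ (2 + nu))).
  by have [] := X_moment S s.
have X_bound S s : {ae P S, forall x, condE (P S) (F0 S) (fun y => `|X S s y| `^ (2 + nu)) x <= KX}.
  by have [] := X_moment S s.
have Y0_int S i : (P S).-integrable setT (EFin \o (fun x => Y0 S i x ^+ 2)).
  by have [] := Y0_moment S i.
have Y0_bound S i : {ae P S, forall x,
    condE (P S) (gen_W (w S)) (fun y => Y0 S i y ^+ 2) x <= KY}.
  by have [] := Y0_moment S i.
have est S := estimand_clipped (w_ge0 S) (w_le1 S) (outcome S) (X_mean0 S) (X_indep S)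
  (b_bounded S) nu_gt0 (X_int S) (X_bound S) (Y0_int S).
have rat S := weighted_ratio_clipped (w_ge0 S) (w_le1 S) (X_mean0 S) (b_bounded S) nu_gt0 (X_int S).
split=> [S|].
  by apply: filterS2 (est S) (rat S) => x -> ->.
have K0 : 0 <= `|Kb| by [].
pose w' S := clip_w (w S).
pose b' S := clip_b (b S) `|Kb|.
pose conc S x := concentration (fun i s => w' S i s x).
have mconc S : measurable_fun setT (conc S).
  exact: (measurable_concentration (mF S) (@gen_W_F0 _ _ _ (P S) _ _ (Y0 S) (b S) (w S))
    (@measurable_clip_w _ _ _ (P S) _ _ (w S))).
have conc01 S x : `|conc S x| <= 1.
  rewrite ger0_norm ?concentration_ge0// /conc; apply: concentration_le1.
    by move=> i s; exact: clip_w_ge0.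
  by move=> i; exact: clip_w_le1.
have conc0 S x : 0 <= conc S x by exact: concentration_ge0.
(* The rows live on different spaces, so the almost sure limit of the shares is a statement on
   [Omega]. Each expectation is transported there through the law of [row S], and dominated
   convergence applies with bound 1. *)
have conc_cvg0 : (\int[P S]_x (conc S x)%:E)%E @[S --> \oo] --> 0%E.
  have -> : (fun S => \int[P S]_x (conc S x)%:E)%E = (fun S => \int[Q]_o (conc S (row S o))%:E)%E.
    apply/funext => S.
    transitivity (\int[pushforward Q (row S)]_x (conc S x)%:E)%E.
      by apply: eq_measure_integral => A mA _; apply/esym; exact: rowP.
    rewrite ge0_integral_pushforward//; first exact: measurableT_comp.
    by move=> x _; rewrite lee_fin.
  have cst1 : Q.-integrable setT (cst 1%:E) by exact: finite_measure_integrable_cst.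
  have [] := @dominated_convergence _ _ _ Q setT measurableT
    (fun S o => (conc S (row S o))%:E) (cst 0%E) (cst 1%:E).
  - by move=> S; apply: measurableT_comp => //; exact: measurableT_comp.
  - exact: measurable_cst.
  - apply: filterS no_large_sector => o cv _.
    apply: cvg_EFin; first exact: nearW.
    apply: (@squeeze_cvgr _ _ _ _ (cst 0) (fun S => `|max_sector_share (w S) (row S o)|)).
    + by apply: nearW => S; rewrite /= conc0; exact: concentration_clip_le.
    + exact: cvg_cst.
    + by rewrite -[X in _ --> X](@normr0 _ R); exact: cvg_norm.
  - exact: cst1.
  - by apply: aeW => o S _; rewrite /= lee_fin.
  by move=> _ _; rewrite integral0.
have sqY0 S i : sqi (P S) (Y0 S i) by split.
have mw' S i s : measurable_fun [set: g_sigma_algebraType (gen_W (w S))] (w' S i s).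
  exact: measurable_clip_w.
have w'0 S i s x : 0 <= w' S i s x by exact: clip_w_ge0.
have w'1 S i x : \sum_s w' S i s x <= 1 by exact: clip_w_le1.
have mb' S i s : measurable_fun [set: g_sigma_algebraType (F0 S)] (b' S i s).
  exact: measurable_clip_b.
have b'K S i s x : `|b' S i s x| <= `|Kb| by exact: clip_b_le.
have gWF S A : <<s gen_W (w S) >> A -> <<s F0 S >> A by exact: gen_W_F0.
have mY S i : measurable_fun [set: g_sigma_algebraType (F0 S)] (Y0 S i).
  exact: measurable_gen_F0_Y0.
pose one S (i : 'I_(N S)) (s : 'I_S) (x : T S) : R := 1.
pose zero S (i : 'I_(N S)) (x : T S) : R := 0.
have m1 S i s : measurable_fun [set: g_sigma_algebraType (F0 S)] (one S i s).
  exact: measurable_cst.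
have m0 S i : measurable_fun [set: g_sigma_algebraType (F0 S)] (zero S i).
  exact: measurable_cst.
have b1 S i s x : `|one S i s x| <= 1 by rewrite normr1.
have sq0 S i : sqi (P S) (zero S i) by exact: sqi0.
have bd0 S i : {ae P S, forall x, condE (P S) (gen_W (w S)) (fun y => zero S i y ^+ 2) x <= 0}.
  have e : (fun y : T S => zero S i y ^+ 2) = cst 0 by apply/funext => y; rewrite expr0n.
  rewrite e.
  by apply: filterS (condE_cst (P S) (@gen_W_measurable _ _ _ (P S) _ _ (w S)) 0) => x ->.
have cA := cvg_numerator_error R N d T P F0 (fun S => gen_W (w S)) mF gWF X X_indep X_mean0
  nu KX KY `|Kb| nu_gt0 X_int X_bound w' b' (fun S i => Y0 S i) mw' w'0 w'1 mb' K0 b'K mY sqY0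
  Y0_bound conc_cvg0.
have cB := cvg_numerator_error R N d T P F0 (fun S => gen_W (w S)) mF gWF X X_indep X_mean0
  nu KX 0 1 nu_gt0 X_int X_bound w' one zero mw' w'0 w'1 m1 ler01 b1 m0 sq0 bd0 conc_cvg0.
have mA := measurable_numerator_error R N d T P F0 (fun S => gen_W (w S)) mF gWF X X_indep X_mean0
  nu KX KY `|Kb| nu_gt0 X_int X_bound w' b' (fun S i => Y0 S i) mw' w'0 w'1 mb' K0 b'K mY sqY0
  Y0_bound.
have mB := measurable_numerator_error R N d T P F0 (fun S => gen_W (w S)) mF gWF X X_indep X_mean0
  nu KX 0 1 nu_gt0 X_int X_bound w' one zero mw' w'0 w'1 m1 ler01 b1 m0 sq0 bd0.
pose V S x := (N S)%:R^-1 * (\sum_(i < N S) \sum_(s < S)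
  condVar (P S) (F0 S) (X S s) x * w S i s x ^+ 2) - c.
have mV S : measurable_fun setT (V S).
  apply: measurable_funB => //; apply: measurable_funM => //.
  apply: measurable_sum => i; apply: measurable_sum => s; apply: measurable_funM.
    by apply: measurable_condE_ambient; exact: mF.
  exact: measurable_funX.
have cV : cvg_in_prob P V 0.
  by move=> e e0; have := var_cvg e e0; under eq_fun do under eq_set do rewrite -[X in `|X|]subr0.
have mZ S : measurable_fun setT
    (fun x => beta_hat (Y S) (w S) (X S) x - estimand (F0 S) (Y S) (w S) (X S) x).
  by apply: measurable_funB; [exact: measurable_beta_hat|exact: measurable_estimand].
apply: (cvg_in_prob_continuous mZ mA mB mV cA cB cV) => e e0.
have [r r0 ratio] := ratio_continuous c_gt0 K0 e0.
exists r => // S.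
have hat := beta_hat_clipped (w_ge0 S) (w_le1 S) (outcome S) (b_bounded S) (X := X S).
have var := condVar_sum_clipped (w_ge0 S) (w_le1 S) (X_mean0 S) nu_gt0 (X_int S).
have le0 := clipped_le (Y0 S) (b S) (w S) Kb nu_gt0 (X_int S).
apply: filterS2 (filterI (est S) hat) (filterI var le0).
move=> x [-> ->] [vE le] hA hB hV.
(* The common scale is the one in [numerator_error] and in the variance condition; [hA], [hB] and
   [hV] are the three smallness conditions of [ratio_continuous]. *)
apply: (ratio (N S)%:R^-1) => //.
by move: hV; rewrite /V vE.
Qed.
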